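(* Let $\Gamma,\tilde\Gamma$ be groups, let $\alpha\in\mathrm{End}(\Gamma)$ be an endomorphism and let $\tilde\alpha_0,\tilde\alpha_1\in\mathrm{End}(\tilde\Gamma)$ be two injective endomorphisms. Let $\varepsilon_\Gamma\in \mathrm{End}(\Gamma)$ be the trivial endomorphism $g\mapsto e_\Gamma$. Let $G=K\rtimes V$ and $\tilde G=\tilde K\rtimes V$ be the fraction groups built from the triples $(\Gamma,\alpha,\varepsilon_\Gamma)$ and $(\tilde\Gamma,\tilde\alpha_0,\tilde\alpha_1)$ respectively. Then: (1) If $K$ or $\tilde K$ is nontrivial, then there are no isomorphisms between $K\rtimes V$ and $\tilde K\rtimes V$. (2) If $\tilde K$ is nontrivial, then there are no injective $V$-equivariant morphisms from $\tilde K$ to $K$. (3) If $K$ is nontrivial, then there are no $V$-equivariant morphisms from $K$ to $\tilde K$.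
   Context: Let $\mathfrak C=\{0,1\}^{\mathbf N}$ be the Cantor space. A standard dyadic interval (sdi) is a set $I=\{m_I\cdot y: y\in\mathfrak C\}$ of all sequences with a given finite prefix $m_I$; a standard dyadic partition (sdp) is a finite partition of $\mathfrak C$ into sdi. Thompson's group $V$ is the group of homeomorphisms $v$ of $\mathfrak C$ for which there are two sdp $(I_k)_{1\le k\le n}$, $(J_k)_{1\le k\le n}$ with $v(m_{I_k}\cdot x)=m_{J_k}\cdot x$ for all $k$ and all $x\in\mathfrak C$. Let $\mathfrak T$ be the set of finite rooted ordered binary trees (every vertex has $0$ or $2$ children). A leaf $\ell$ of $t\in\mathfrak T$ is identified with the finite word $m_\ell$ in $0,1$ describing the path from the root to $\ell$ ($0$ = left, $1$ = right); trees thus correspond to sdp. Write $s\ge t$ if $s$ is obtained from $t$ by attaching trees to the leaves of $t$. Given a triple $(\Gamma,\alpha_0,\alpha_1)$ with $\Gamma$ a group and $\alpha_0,\alpha_1\in\mathrm{End}(\Gamma)$, put $\alpha_w=\alpha_{l_n}\circ\cdots\circ\alpha_{l_1}$ for a finite word $w=l_1\cdots l_n$. For $t\in\mathfrak T$ let $\Gamma_t=\Gamma^{\mathrm{Leaf}(t)}$, and for $s\ge t$ let $\iota_{s,t}:\Gamma_t\to\Gamma_s$ be the morphism sending $(g_\ell)_{\ell}$ to the family whose coordinate at a leaf of $s$ with word $m_\ell\cdot w$ ($\ell\in\mathrm{Leaf}(t)$) is $\alpha_w(g_\ell)$. Let $K=\varinjlim_{t\in\mathfrak T}\Gamma_t$.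 The Jones action $V\curvearrowright K$ by automorphisms is defined as follows: given $v\in V$ and an element of $K$, choose trees $t,s$ such that $v$ maps the sdp of $t$ to the sdp of $s$ as in the definition of $V$, inducing a bijection $b:\mathrm{Leaf}(t)\to\mathrm{Leaf}(s)$, and such that the element is represented by some $g\in\Gamma_t$ (always possible for $t$ large enough); then $v$ sends the class of $g\in\Gamma_t$ to the class of $g\circ b^{-1}\in\Gamma_s$. The fraction group built from $(\Gamma,\alpha_0,\alpha_1)$ is the semidirect product $K\rtimes V$. Morphisms between such limit groups are group morphisms, and their $V$-equivariance is with respect to the Jones actions.
   Formalization: In part (3) the formal theorem excludes only injective V-equivariant morphisms from K to K̃; without ''injective'' the claim is false, since the trivial morphism is always V-equivariant (and nontrivial non-injective ones can exist, e.g. for Γ=Γ̃=ℤ with α=α̃₀=α̃₁=id). *)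

(* Defs.v *)
From HB Require Import structures.
From mathcomp Require Import all_boot.
From mathcomp Require Import generic_quotient.
From mathcomp Require Import boolp classical_sets functions topology cantor.

Set Implicit Arguments.
Unset Strict Implicit.
Unset Printing Implicit Defensive.

Local Open Scope classical_set_scope.
Local Open Scope quotient_scope.
Local Open Scope group_scope.

(** The letters 0 and 1 are [false] (left) and [true] (right). *)

Notation word := (seq bool).

Definition ccons (b : bool) (x : cantor_space) : cantor_space :=
  fun n => if n is n'.+1 then x n' else b.

Definition wcat (m : word) (x : cantor_space) : cantor_space := foldr ccons x m.

Definition sdi (m : word) : set cantor_space := range (wcat m).

(** Disjointness is that of the family: distinct indices give disjoint
    intervals, so the [n] intervals are automatically distinct. *)
Definition sdp (n : nat) (m : 'I_n -> word) : Prop :=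
  partition setT (fun k => sdi (m k)) setT.

Definition dyadic_map (v : cantor_space -> cantor_space) : Prop :=
  exists (n : nat) (I J : 'I_n -> word),
    [/\ sdp I, sdp J & forall k x, v (wcat (I k) x) = wcat (J k) x].

(** Homeomorphisms bundled with their inverse; by [thompsonV_eq] two elements
    are equal as soon as the underlying maps agree. *)
Record thompsonV := ThompsonV {
  Vfun :> cantor_space -> cantor_space;
  Vinv : cantor_space -> cantor_space;
  VfunK : cancel Vfun Vinv;
  VinvK : cancel Vinv Vfun;
  Vfun_continuous : continuous Vfun;
  Vinv_continuous : continuous Vinv;
  Vfun_dyadic : dyadic_map Vfun }.

HB.instance Definition _ := gen_eqMixin thompsonV.
HB.instance Definition _ := gen_choiceMixin thompsonV.

Lemma thompsonV_eq (u v : thompsonV) : Vfun u =1 Vfun v -> u = v.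
Proof.
move=> /funext.
case: u => uf ui uK iuK cu ciu du; case: v => vf vi vK ivK cv civ dv /= E.
rewrite -{}E in vK ivK cv dv *.
have E : vi = ui by apply/funext => x; rewrite -{1}[x]iuK vK.
rewrite {}E in vK ivK civ *.
by congr ThompsonV; apply: Prop_irrelevance.
Qed.

Inductive tree := Leaf | Node of tree & tree.

HB.instance Definition _ := gen_eqMixin tree.
HB.instance Definition _ := gen_choiceMixin tree.

Fixpoint leaves (t : tree) : seq word :=
  if t is Node l r
  then map (cons false) (leaves l) ++ map (cons true) (leaves r)
  else [:: [::]].

Notation leaf t := (seq_sub (leaves t)).

(** Attaches the tree [f m] to every leaf [m] of [t]; the values of [f] at
    the words that are not leaves of [t] are irrelevant. *)
Fixpoint attach (t : tree) (f : word -> tree) : tree :=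
  if t is Node l r
  then Node (attach l (f \o cons false)) (attach r (f \o cons true))
  else f [::].

Definition tree_le (t s : tree) : Prop := exists f, s = attach t f.

(** [v] maps the partition of [t] to that of [s], inducing [b] on leaves. *)
Definition carries (v : cantor_space -> cantor_space) (t s : tree)
    (b : leaf t -> leaf s) : Prop :=
  forall (l : leaf t) x, v (wcat (val l) x) = wcat (val (b l)) x.

Lemma wcat_cat m w x : wcat (m ++ w) x = wcat m (wcat w x).
Proof. exact: foldr_cat. Qed.

Lemma ccons_inj b b' x x' : ccons b x = ccons b' x' -> b = b' /\ x = x'.
Proof.
move=> E; split; first by have := congr1 (fun f => f 0%N) E.
by apply/funext => n; have := congr1 (fun f => f n.+1) E.
Qed.

Lemma ccons_surj (x : cantor_space) :
  x = ccons (x 0%N) ((fun n => x n.+1) : cantor_space).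
Proof. by apply/funext => -[]. Qed.

Lemma wcat_inj m : injective (wcat m).
Proof. by elim: m => //= b m IH x y /ccons_inj[_ /IH]. Qed.

Lemma wcat_prefix m m' x y :
  wcat m x = wcat m' y -> prefix m m' \/ prefix m' m.
Proof.
elim: m m' => [|b m IH] [|b' m'] /=; rewrite ?prefix0s; try by [left | right].
by move=> /ccons_inj[<- /IH]; rewrite !eqxx.
Qed.

Lemma wcat_word_inj m m' : (forall x, wcat m x = wcat m' x) -> m = m'.
Proof.
elim: m m' => [|b m IH] [|b' m'] //= E.
- have /(congr1 (fun f => f 0%N)) /= := E (fun=> ~~ b').
  by case: (b').
- have /(congr1 (fun f => f 0%N)) /= := E (fun=> ~~ b).
  by case: (b).
- have [-> _] := ccons_inj (E point).
  by congr cons; apply: IH => x; have [] := ccons_inj (E x).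
Qed.

Lemma leaves_NodeE l r w : (w \in leaves (Node l r)) =
  if w is b :: w' then w' \in leaves (if b then r else l) else false.
Proof.
rewrite /= mem_cat; case: w => [|b w].
  by apply/negbTE; rewrite negb_or; apply/andP; split; apply/mapP => -[].
have cI c : injective (@cons bool c) by move=> ? ? [].
have cN c c' s : c != c' -> (c :: w \in [seq c' :: i | i <- s]) = false.
  by move=> cc'; apply/negbTE/mapP => -[w' _ [] E]; rewrite E eqxx in cc'.
by case: b; rewrite (mem_map (@cI _)) cN ?orbF.
Qed.

Lemma leaf_prefix t m m' :
  m \in leaves t -> m' \in leaves t -> prefix m m' -> m = m'.
Proof.
elim: t m m' => [|l IHl r IHr] m m'.
  by rewrite /= !inE => /eqP-> /eqP->.
rewrite !leaves_NodeE; case: m m' => [|b m] [|b' m'] // mt m't.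
rewrite prefix_cons => /andP[/eqP E p]; rewrite -E in m't *; congr cons.
by case: {E} b mt m't => mt m't; [exact: IHr mt m't p | exact: IHl mt m't p].
Qed.

Lemma leaf_disj t m m' x y : m \in leaves t -> m' \in leaves t ->
  wcat m x = wcat m' y -> m = m'.
Proof.
move=> mt m't /wcat_prefix[p|p]; first exact: leaf_prefix mt m't p.
by apply/esym; exact: leaf_prefix m't mt p.
Qed.

Lemma leaf_cover t x : exists2 m, m \in leaves t & exists y, x = wcat m y.
Proof.
elim: t x => [|l IHl r IHr] x; first by exists [::]; [rewrite inE | exists x].
rewrite (ccons_surj x); case: (x 0%N).
  have [m mr [y ->]] := IHr (fun n => x n.+1).
  by exists (true :: m); [rewrite leaves_NodeE | exists y].
have [m mr [y ->]] := IHl (fun n => x n.+1).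
by exists (false :: m); [rewrite leaves_NodeE | exists y].
Qed.

Lemma tree_leP t s : tree_le t s <->
  forall m, m \in leaves s -> exists2 l, l \in leaves t & prefix l m.
Proof.
split=> [[f ->]|].
  elim: t f => [|l IHl r IHr] f m.
    by move=> _; exists [::]; rewrite ?inE ?prefix0s.
  rewrite [attach _ _]/= leaves_NodeE; case: m => [|[] m] //.
    by move=> /IHr[k kr km]; exists (true :: k); rewrite ?leaves_NodeE //= eqxx.
  by move=> /IHl[k kr km]; exists (false :: k); rewrite ?leaves_NodeE //= eqxx.
elim: t s => [|l IHl r IHr] s H; first by exists (fun=> s).
case: s H => [|l' r'] H.
  have [|k] := H [::]; first by rewrite inE.
  by rewrite leaves_NodeE; case: k.
have [|fl El] := IHl l'.
  move=> m ml'; have [|k] := H (false :: m); first by rewrite leaves_NodeE.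
  by rewrite leaves_NodeE; case: k => [|[] k] //=; exists k.
have [|fr Er] := IHr r'.
  move=> m ml'; have [|k] := H (true :: m); first by rewrite leaves_NodeE.
  by rewrite leaves_NodeE; case: k => [|[] k] //=; exists k.
exists (fun w => if w is b :: w' then if b then fr w' else fl w' else Leaf).
by rewrite El Er.
Qed.

Lemma tree_le_refl t : tree_le t t.
Proof. by apply/tree_leP => m mt; exists m; rewrite ?prefix_refl. Qed.
#[global] Hint Resolve tree_le_refl : core.

Lemma tree_le_trans t s r : tree_le t s -> tree_le s r -> tree_le t r.
Proof.
move=> /tree_leP ts /tree_leP sr; apply/tree_leP => m /sr[l /ts[k kt kl] lm].
by exists k => //; apply: prefix_trans kl lm.
Qed.

Fixpoint tree_join (t s : tree) : tree :=
  match t, s with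
  | Node l r, Node l' r' => Node (tree_join l l') (tree_join r r')
  | Leaf, _ => s
  | _, Leaf => t
  end.

Lemma tree_joinl t s : tree_le t (tree_join t s).
Proof.
elim: t s => [|l IHl r IHr] [|l' r'] //; first by exists (fun=> Node l' r').
have [f E] := IHl l'; have [g E'] := IHr r'; rewrite /= E E' {E E'}.
by exists (fun w => if w is b :: w' then if b then g w' else f w' else Leaf).
Qed.

Lemma tree_joinC t s : tree_join t s = tree_join s t.
Proof. by elim: t s => [|l IHl r IHr] [|l' r'] //=; rewrite IHl IHr. Qed.

Lemma tree_joinr t s : tree_le s (tree_join t s).
Proof. by rewrite tree_joinC; exact: tree_joinl. Qed.

Lemma tree_join_le t s r : tree_le t r -> tree_le s r -> tree_le (tree_join t s) r.
Proof.
move=> [f ->] [g]; elim: t s f g => [|l IHl r' IHr] [|l' r''] f g /=.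
- by exists f.
- by move=> ->; exists g.
- by exists f.
- case=> /IHl[h ->] /IHr[h' ->].
  by exists (fun w => if w is b :: w' then if b then h' w' else h w' else Leaf).
Qed.

Lemma tree_le_leaf t s (m : leaf s) : tree_le t s ->
  exists (l : leaf t) (w : word), val m = val l ++ w.
Proof.
move=> /tree_leP /(_ _ (ssvalP m))[l lt /prefixP[w mE]].
by exists (SeqSub lt), w.
Qed.

Lemma sdp_tree_aux N (A : word -> Prop) :
  (forall m, A m -> size m <= N)%N ->
  (forall x, exists2 m, A m & sdi m x) ->
  (forall m m' x y, A m -> A m' -> wcat m x = wcat m' y -> m = m') ->
  exists t, forall m, m \in leaves t <-> A m.
Proof.
elim: N A => [|N IH] A sA cA dA.
  exists Leaf => m; rewrite inE; split=> [/eqP->|/sA]; last by case: m.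
  by have [k Ak _] := cA point; have := sA _ Ak; case: k Ak.
have [A0|A0] := pselect (A [::]).
  exists Leaf => m; rewrite inE; split=> [/eqP->//|Am].
  by apply/eqP; apply: (dA _ _ point (wcat m point) Am A0).
have H b : exists t, forall m, m \in leaves t <-> A (b :: m).
  apply: IH => [m /sA//|x|m m' x y Am Am' E].
    have [[|b' m] Am [y _ /= E]] := cA (ccons b x) => //.
    by have [<- <-] := ccons_inj E; exists m => //; exists y.
  suff [] : b :: m = b :: m' by [].
  by apply: (dA _ _ x y) => //=; rewrite E.
have [l Hl] := H false; have [r Hr] := H true.
exists (Node l r) => -[|b m]; rewrite leaves_NodeE; first by split.
by case: b; [exact: Hr | exact: Hl].
Qed.

Lemma sdp_tree n (I : 'I_n -> word) : sdp I ->
  exists t, forall m, m \in leaves t <-> exists k, m = I k.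
Proof.
move=> [cI tI _].
apply: (@sdp_tree_aux (\max_(k < n) size (I k))%N (fun m => exists k, m = I k)).
- by move=> _ [k ->]; apply: (leq_bigmax k).
- move=> x; have : cover setT (fun k => sdi (I k)) x by rewrite cI.
  by case=> k _ Ik; exists (I k) => //; exists k.
- move=> _ _ x y [k ->] [k' ->] E; congr I; apply: tI => //.
  by exists (wcat (I k) x); split; [exists x | exists y].
Qed.

Lemma tree_sdp n t (I : 'I_n -> leaf t) :
  bijective I -> sdp (fun k => val (I k)).
Proof.
case=> J IK JK; split.
- rewrite -subTset => x _; have [m mt [y ->]] := leaf_cover t x.
  by exists (J (SeqSub mt)) => //; rewrite JK; exists y.
- move=> k k' _ _ [x [[y _ yE] [z _ zE]]]; apply: (can_inj IK).
  apply: val_inj; apply: (leaf_disj (ssvalP _) (ssvalP _)).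
  exact: etrans yE (esym zE).
- by move=> k _; exists (wcat (val (I k)) point); exists point.
Qed.

Lemma carries_bij (v : thompsonV) t s (b : leaf t -> leaf s) :
  carries v b -> exists2 c, cancel b c & cancel c b.
Proof.
move=> vb.
have bI : injective b.
  move=> l l' E; apply: val_inj.
  apply: (@leaf_disj t _ _ point point (ssvalP _) (ssvalP _)).
  by apply: (can_inj (VfunK v)); rewrite !vb E.
have bS (m : leaf s) : exists l, b l = m.
  have [l lt [x E]] := leaf_cover t (Vinv v (wcat (val m) point)).
  exists (SeqSub lt); apply: val_inj.
  apply: (@leaf_disj s _ _ x point (ssvalP _) (ssvalP _)).
  by rewrite -(vb (SeqSub lt) x) /= -E VinvK.
have [c cK] := choice bS.
by exists c => // l; apply: bI; rewrite cK.
Qed.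

Lemma carriesI (v vi : cantor_space -> cantor_space) t :
  cancel v vi -> cancel vi v ->
  (forall l : leaf t, exists m, forall x, v (wcat (val l) x) = wcat m x) ->
  exists s (b : leaf t -> leaf s), carries v b.
Proof.
move=> vK viK /choice[m mE].
have [||| s sE] := @sdp_tree_aux (\max_(l : leaf t) size (m l))%N
   (fun w => exists l, w = m l).
- by move=> _ [l ->]; apply: (leq_bigmax l).
- move=> x; have [l lt [y E]] := leaf_cover t (vi x).
  exists (m (SeqSub lt)); first by exists (SeqSub lt).
  by exists y => //; rewrite -mE /= -E viK.
- move=> _ _ x y [l ->] [l' ->]; rewrite -!mE => /(can_inj vK) E.
  by congr m; apply: val_inj; apply: leaf_disj E; apply: ssvalP.
have ms l : m l \in leaves s by apply/sE; exists l.
by exists s, (fun l => SeqSub (ms l)) => l x; rewrite mE.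
Qed.

Lemma dyadic_carries (v vi : cantor_space -> cantor_space) :
  cancel v vi -> cancel vi v -> dyadic_map v ->
  exists t s (b : leaf t -> leaf s), carries v b.
Proof.
move=> vK viK [n [I [J [sI _ IJ]]]]; have [t tE] := sdp_tree sI.
exists t; apply: carriesI => // l.
by have [k lE] := (tE _).1 (ssvalP l); exists (J k) => x; rewrite -IJ -lE.
Qed.

Lemma thompsonV_carries (v : thompsonV) :
  exists t s (b : leaf t -> leaf s), carries v b.
Proof. exact: dyadic_carries (VfunK v) (VinvK v) (Vfun_dyadic v). Qed.

Lemma carries_dyadic v t s (b : leaf t -> leaf s) :
  bijective b -> carries v b -> dyadic_map v.
Proof.
move=> bb vb; exists #|{: leaf t}|, (fun k => val (enum_val k)).
exists (fun k => val (b (enum_val k))); split=> [||k x]; last exact: vb.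
- exact/tree_sdp/enum_val_bij.
- exact/(tree_sdp (I := b \o enum_val))/(bij_comp bb)/enum_val_bij.
Qed.

Lemma carries_refine (v : thompsonV) t s (b : leaf t -> leaf s) r :
  carries v b -> tree_le t r -> exists q (b' : leaf r -> leaf q), carries v b'.
Proof.
move=> vb tr; apply: carriesI (VfunK v) (VinvK v) _ => l.
have [k [w ->]] := tree_le_leaf l tr.
by exists (val (b k) ++ w) => x; rewrite !wcat_cat vb.
Qed.

Lemma carries_at (v : thompsonV) r : exists t s (b : leaf t -> leaf s),
  tree_le r t /\ carries v b.
Proof.
have [t [s [b vb]]] := thompsonV_carries v.
have [q [b' vb']] := carries_refine vb (tree_joinl t r).
by exists (tree_join t r), q, b'; split=> //; exact: tree_joinr.
Qed.

Lemma carries_comp (u v : cantor_space -> cantor_space) t s r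
    (b : leaf t -> leaf s) (c : leaf s -> leaf r) :
  carries v b -> carries u c -> carries (u \o v) (c \o b).
Proof. by move=> vb uc l x; rewrite /= vb uc. Qed.

Lemma carries_inv (v vi : cantor_space -> cantor_space) t s
    (b : leaf t -> leaf s) c :
  cancel v vi -> cancel c b -> carries v b -> carries vi c.
Proof. by move=> vK cK vb l x; apply: (canLR vK); rewrite vb cK. Qed.

Lemma V1_dyadic : dyadic_map id.
Proof. by apply: (@carries_dyadic _ Leaf Leaf id) => //; exists id. Qed.

Lemma VV_dyadic (v : thompsonV) : dyadic_map (Vinv v).
Proof.
have [t [s [b vb]]] := thompsonV_carries v; have [c bK cK] := carries_bij vb.
apply: (@carries_dyadic _ s t c); first by exists b.
exact: carries_inv (VfunK v) cK vb.
Qed.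

Definition V1 := @ThompsonV id id (fun=> erefl) (fun=> erefl)
  (fun x => cvg_id) (fun x => cvg_id) V1_dyadic.

Definition VV (v : thompsonV) := ThompsonV (VinvK v) (VfunK v)
  (@Vinv_continuous v) (@Vfun_continuous v) (VV_dyadic v).

Lemma VM_common (u v : thompsonV) :
  exists t s r (b : leaf t -> leaf s) (c : leaf s -> leaf r),
    carries v b /\ carries u c.
Proof.
have [t0 [s0 [b0 vb0]]] := thompsonV_carries v.
have [s [r [c [s0s uc]]]] := carries_at u s0.
have [c0 b0K c0K] := carries_bij vb0.
have vc0 : carries (VV v) c0 by exact: carries_inv (VfunK v) c0K vb0.
have [t [b1 vb1]] := carries_refine vc0 s0s.
have [b b1K bK] := carries_bij vb1.
exists t, s, r, b, c; split=> //; exact: carries_inv (VinvK v) bK vb1.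
Qed.

Lemma VM_dyadic (u v : thompsonV) : dyadic_map (u \o v).
Proof.
have [t [s [r [b [c [vb uc]]]]]] := VM_common u v.
have [b' bK b'K] := carries_bij vb; have [c' cK c'K] := carries_bij uc.
apply: carries_dyadic (carries_comp vb uc).
by apply: bij_comp; [exists c' | exists b'].
Qed.

Definition VM (u v : thompsonV) := ThompsonV
  (can_comp (VfunK u) (VfunK v)) (can_comp (VinvK v) (VinvK u))
  (fun x => continuous_comp (@Vfun_continuous v x) (@Vfun_continuous u (v x)))
  (fun x => continuous_comp (@Vinv_continuous u x)
                            (@Vinv_continuous v (Vinv u x)))
  (VM_dyadic u v).

Lemma VMA : associative VM.
Proof. by move=> u v w; apply: thompsonV_eq. Qed.
Lemma V1M : left_id V1 VM.
Proof. by move=> v; apply: thompsonV_eq. Qed.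
Lemma VM1 : right_id V1 VM.
Proof. by move=> v; apply: thompsonV_eq. Qed.
Lemma VVM : left_inverse V1 VV VM.
Proof. by move=> v; apply: thompsonV_eq => x; exact: VfunK. Qed.
Lemma VMV : right_inverse V1 VV VM.
Proof. by move=> v; apply: thompsonV_eq => x; exact: VinvK. Qed.

HB.instance Definition _ := isGroup.Build thompsonV VMA V1M VM1 VVM VMV.

Lemma V1E x : (1 : thompsonV) x = x. Proof. by []. Qed.
Lemma VME (u v : thompsonV) x : (u * v) x = u (v x). Proof. by []. Qed.

Lemma multiplicative1 (G H : groupType) (f : {multiplicative G -> H}) : f 1 = 1.
Proof. by apply: (@mulgI _ (f 1)); rewrite -gmulfM !mulg1. Qed.

Lemma multiplicativeV (G H : groupType) (f : {multiplicative G -> H}) x :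
  f x^-1 = (f x)^-1.
Proof.
by apply: (@mulgI _ (f x)); rewrite -gmulfM !mulgV multiplicative1.
Qed.

Section DirectLimit.
Variables (G : groupType) (a0 a1 : {multiplicative G -> G}).

(** The first letter of [w] acts first. *)
Definition alpha (w : word) (g : G) : G :=
  foldl (fun h (b : bool) => (if b then a1 else a0) h) g w.

Local Notation Gam t := {ffun leaf t -> G}.

(** Relevant for [tree_le t s] only: then every leaf [m] of [s] has exactly
    one leaf of [t] as a prefix. *)
Definition iota (t s : tree) (g : Gam t) : Gam s :=
  [ffun m : leaf s =>
     if [pick l : leaf t | prefix (val l) (val m)] is Some l
     then alpha (drop (size (val l)) (val m)) (g l) else (1 : G)].

Definition limit_elt : choiceType := {t : tree & Gam t}.

Definition limit_eqv : rel limit_elt := fun x y =>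
  `[< exists r, [/\ tree_le (tag x) r, tree_le (tag y) r
                  & iota r (tagged x) = iota r (tagged y)] >].

Lemma alpha_cat w w' g : alpha (w ++ w') g = alpha w' (alpha w g).
Proof. exact: foldl_cat. Qed.

Lemma alphaM w : {morph alpha w : g h / g * h}.
Proof. by elim: w => // -[] w IH g h; rewrite /alpha /= gmulfM [LHS]IH. Qed.

Lemma alpha1 w : alpha w 1 = 1.
Proof. by elim: w => // -[] w IH; rewrite /alpha /= multiplicative1 [LHS]IH. Qed.

Lemma alphaV w g : alpha w g^-1 = (alpha w g)^-1.
Proof. by elim: w g => // -[] w IH g; rewrite /alpha /= multiplicativeV [LHS]IH. Qed.

Lemma iotaE t s (g : Gam t) (l : leaf t) (m : leaf s) w :
  val m = val l ++ w -> iota s g m = alpha w (g l).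
Proof.
move=> mE; rewrite ffunE; case: pickP => [k|/(_ l)]; last first.
  by rewrite mE prefix_prefix.
move=> pk; suff -> : k = l by rewrite mE drop_size_cat.
have [u Eu] := prefixP pk.
apply: val_inj; apply: (@leaf_disj t _ _ (wcat u point) (wcat w point));
  try exact: ssvalP.
by rewrite -!wcat_cat -Eu -mE.
Qed.

Lemma iota_id t (g : Gam t) : iota t g = g.
Proof. by apply/ffunP => l; rewrite (@iotaE _ _ _ l _ [::]) ?cats0. Qed.

Lemma iota_comp t s r (g : Gam t) :
  tree_le t s -> tree_le s r -> iota r (iota s g) = iota r g.
Proof.
move=> ts sr; apply/ffunP => m.
have [l [w mE]] := tree_le_leaf m sr; have [k [u lE]] := tree_le_leaf l ts.
rewrite (iotaE _ mE) (iotaE _ lE) (@iotaE _ _ _ k _ (u ++ w)) ?alpha_cat //.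
by rewrite mE lE catA.
Qed.

Lemma iotaM t s : {morph @iota t s : g h / g * h}.
Proof.
move=> g h; apply/ffunP => m; rewrite !ffunE; case: pickP => [l _|_].
  by rewrite !ffunE alphaM.
by rewrite mulg1.
Qed.

HB.instance Definition _ t s :=
  isMultiplicative.Build (Gam t) (Gam s) (@iota t s) (@iotaM t s).

Lemma limit_eqvP x y : reflect
  (exists r, [/\ tree_le (tag x) r, tree_le (tag y) r
               & iota r (tagged x) = iota r (tagged y)]) (limit_eqv x y).
Proof. exact: asboolP. Qed.

Lemma limit_eqv_refl : reflexive limit_eqv.
Proof. by move=> x; apply/limit_eqvP; exists (tag x). Qed.

Lemma limit_eqv_sym : symmetric limit_eqv.
Proof.
by move=> x y; apply/limit_eqvP/limit_eqvP => -[r [xr yr E]]; exists r.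
Qed.

Lemma limit_eqv_trans : transitive limit_eqv.
Proof.
move=> y x z /limit_eqvP[r [xr yr E]] /limit_eqvP[q [yq zq E']].
apply/limit_eqvP; exists (tree_join r q).
have rj := tree_joinl r q; have qj := tree_joinr r q.
split; [exact: tree_le_trans xr rj | exact: tree_le_trans zq qj |].
rewrite -(iota_comp _ xr rj) E iota_comp // -(iota_comp _ zq qj) -E'.
by rewrite iota_comp.
Qed.

Canonical limit_equiv :=
  EquivRel limit_eqv limit_eqv_refl limit_eqv_sym limit_eqv_trans.

Definition limit : Type := {eq_quot limit_equiv}.
HB.instance Definition _ := Choice.on limit.

Definition to_limit (t : tree) (g : Gam t) : limit :=
  \pi_({eq_quot limit_equiv}) (Tagged (fun t => Gam t) g : limit_elt).

Lemma to_limitP t s (g : Gam t) (h : Gam s) :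
  to_limit g = to_limit h <->
  exists r, [/\ tree_le t r, tree_le s r & iota r g = iota r h].
Proof.
split=> [/eqmodP/limit_eqvP//|E].
by apply/eqmodP/limit_eqvP.
Qed.

Lemma to_limit_iota t s (g : Gam t) : tree_le t s -> to_limit (iota s g) = to_limit g.
Proof. by move=> ts; apply/to_limitP; exists s; split; rewrite ?iota_id. Qed.

Lemma to_limit_surj (k : limit) : exists t (g : Gam t), k = to_limit g.
Proof.
exists (tag (repr k)), (tagged (repr k)).
by rewrite /to_limit; case: (repr k) (reprK k) => t g /= <-.
Qed.

Lemma limit_at (k : limit) r :
  exists t (g : Gam t), tree_le r t /\ k = to_limit g.
Proof.
have [t [g ->]] := to_limit_surj k.
exists (tree_join r t), (iota _ g); split; first exact: tree_joinl.
by rewrite to_limit_iota //; exact: tree_joinr.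
Qed.

Lemma limit_at2 (k k' : limit) :
  exists t (g g' : Gam t), k = to_limit g /\ k' = to_limit g'.
Proof.
have [t [g ->]] := to_limit_surj k; have [s [g' [ts ->]]] := limit_at k' t.
by exists s, (iota s g), g'; rewrite to_limit_iota.
Qed.

Definition limitM (k k' : limit) : limit :=
  let r := tree_join (tag (repr k)) (tag (repr k')) in
  to_limit (iota r (tagged (repr k)) * iota r (tagged (repr k'))).

Definition limitV (k : limit) : limit := to_limit (tagged (repr k))^-1.

Definition limit1 : limit := to_limit (1 : Gam Leaf).

Lemma iota1 t s : iota s (1 : Gam t) = 1.
Proof. exact: multiplicative1. Qed.

Lemma iotaV t s (g : Gam t) : iota s g^-1 = (iota s g)^-1.
Proof. exact: multiplicativeV. Qed.

Lemma to_limit_repr t (g : Gam t) : exists r,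
  [/\ tree_le t r, tree_le (tag (repr (to_limit g))) r
    & iota r g = iota r (tagged (repr (to_limit g)))].
Proof.
apply/to_limitP; have := reprK (to_limit g).
by case: (repr (to_limit g)) => s h /= <-.
Qed.

Lemma limitM_to t (g h : Gam t) :
  limitM (to_limit g) (to_limit h) = to_limit (g * h).
Proof.
rewrite /limitM; set x := repr _; set y := repr _; apply/to_limitP.
have [r [tr xr Er]] := to_limit_repr g; have [q [tq yq Eq]] := to_limit_repr h.
have rj := tree_joinl r q; have qj := tree_joinr r q.
have xj := tree_le_trans xr rj; have yj := tree_le_trans yq qj.
have lej := tree_join_le xj yj.
exists (tree_join r q); split=> //; first exact: tree_le_trans tr rj.
rewrite !iotaM !iota_comp //; first congr (_ * _).
- by rewrite -(iota_comp _ xr rj) -Er iota_comp.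
- by rewrite -(iota_comp _ yq qj) -Eq iota_comp.
- exact: tree_joinr.
- exact: tree_joinl.
Qed.

Lemma limitV_to t (g : Gam t) : limitV (to_limit g) = to_limit g^-1.
Proof.
have [r [tr xr E]] := to_limit_repr g; apply/to_limitP; exists r; split=> //.
by rewrite !iotaV E.
Qed.

Lemma limit1_to t : to_limit (1 : Gam t) = limit1.
Proof.
rewrite /limit1 -(@to_limit_iota Leaf t) ?iota1 //; by exists (fun=> t).
Qed.

Lemma limitMA : associative limitM.
Proof.
move=> k k' k''; have [t [g [g' [-> ->]]]] := limit_at2 k k'.
have [s [h [ts ->]]] := limit_at k'' t.
rewrite -(to_limit_iota g ts) -(to_limit_iota g' ts) !limitM_to.
by rewrite mulgA.
Qed.

Lemma limit1M : left_id limit1 limitM.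
Proof.
move=> k; have [t [g ->]] := to_limit_surj k.
by rewrite -(limit1_to t) limitM_to mul1g.
Qed.

Lemma limitM1 : right_id limit1 limitM.
Proof.
move=> k; have [t [g ->]] := to_limit_surj k.
by rewrite -(limit1_to t) limitM_to mulg1.
Qed.

Lemma limitVM : left_inverse limit1 limitV limitM.
Proof.
move=> k; have [t [g ->]] := to_limit_surj k.
by rewrite limitV_to limitM_to mulVg limit1_to.
Qed.

Lemma limitMV : right_inverse limit1 limitV limitM.
Proof.
move=> k; have [t [g ->]] := to_limit_surj k.
by rewrite limitV_to limitM_to mulgV limit1_to.
Qed.

HB.instance Definition _ := isGroup.Build limit limitMA limit1M limitM1 limitVM limitMV.

Lemma to_limitM t : {morph @to_limit t : g h / g * h}.
Proof. by move=> g h; rewrite -limitM_to. Qed.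

HB.instance Definition _ t :=
  isMultiplicative.Build (Gam t) limit (@to_limit t) (@to_limitM t).

Definition jones_rel (v : thompsonV) (k k' : limit) : Prop :=
  exists (t s : tree) (b : leaf t -> leaf s) (c : leaf s -> leaf t) (g : Gam t),
    [/\ cancel b c, cancel c b, carries v b, k = to_limit g
      & k' = to_limit ([ffun m => g (c m)] : Gam s)].

(** [jones_rel v] is total and functional by [jones_rel_ex] and
    [jones_rel_fun], so the default value 1 is never used. *)
Definition jones (v : thompsonV) (k : limit) : limit :=
  xget 1 [set k' | jones_rel v k k'].

Lemma jones_rel_ex v k : exists k', jones_rel v k k'.
Proof.
have [t0 [g0 ->]] := to_limit_surj k.
have [t [s [b [le vb]]]] := carries_at v t0; have [c bK cK] := carries_bij vb.
exists (to_limit ([ffun m => iota t g0 (c m)] : Gam s)), t, s, b, c, (iota t g0).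
by split; rewrite ?to_limit_iota.
Qed.

Lemma jones_rel_fun v k k1 k2 : jones_rel v k k1 -> jones_rel v k k2 -> k1 = k2.
Proof.
move=> [t1 [s1 [b1 [c1 [g1 [b1K c1K vb1 -> ->]]]]]].
move=> [t2 [s2 [b2 [c2 [g2 [b2K c2K vb2 /to_limitP[r [r1 r2 E]] ->]]]]]].
have [q [b vb]] := carries_refine vb1 r1; have [c bK cK] := carries_bij vb.
have key t s b' c' (g : Gam t) : tree_le t r ->
    cancel b' c' -> cancel c' b' -> carries v b' ->
    to_limit ([ffun m => g (c' m)] : Gam s) =
    to_limit ([ffun m => iota r g (c m)] : Gam q).
  move=> tr b'K c'K vb'.
  have H (m : leaf q) : exists (l : leaf t) w,
      val (c m) = val l ++ w /\ val m = val (b' l) ++ w.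
    have [l [w lE]] := tree_le_leaf (c m) tr; exists l, w; split=> //.
    apply: wcat_word_inj => x; rewrite -{1}[m]cK.
    by rewrite -(vb (c m) x) lE !wcat_cat vb'.
  have sq : tree_le s q.
    apply/tree_leP => m mq; have [l [w [_ /= mE]]] := H (SeqSub mq).
    by exists (val (b' l)); [exact: ssvalP | rewrite mE prefix_prefix].
  rewrite -(to_limit_iota _ sq); congr to_limit; apply/ffunP => m.
  have [l [w [cE mE]]] := H m.
  by rewrite (iotaE _ mE) !ffunE b'K -(iotaE _ cE) ffunE.
by rewrite (key _ _ _ _ _ r1 b1K c1K vb1) (key _ _ _ _ _ r2 b2K c2K vb2) E.
Qed.

Lemma jonesP v k : jones_rel v k (jones v k).
Proof.
have [k' kk'] := jones_rel_ex v k.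
exact: (@xgetI _ 1 [set k' | jones_rel v k k'] k').
Qed.

Lemma jonesE v k k' : jones_rel v k k' -> jones v k = k'.
Proof. exact/jones_rel_fun/jonesP. Qed.

Lemma jones_to (v : thompsonV) t s (b : leaf t -> leaf s) c (g : Gam t) :
  cancel b c -> cancel c b -> carries v b ->
  jones v (to_limit g) = to_limit ([ffun m => g (c m)] : Gam s).
Proof. by move=> bK cK vb; apply: jonesE; exists t, s, b, c, g. Qed.

Lemma jonesM v : {morph jones v : k k' / k * k'}.
Proof.
move=> k k'; have [t0 [g [g' [-> ->]]]] := limit_at2 k k'.
have [t [s [b [le vb]]]] := carries_at v t0; have [c bK cK] := carries_bij vb.
rewrite -(to_limit_iota g le) -(to_limit_iota g' le) -to_limitM.
rewrite !(jones_to _ bK cK vb) -to_limitM; congr to_limit.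
by apply/ffunP => m; rewrite !ffunE.
Qed.

HB.instance Definition _ v :=
  isMultiplicative.Build limit limit (jones v) (@jonesM v).

Lemma jones1 k : jones 1 k = k.
Proof.
have [t [g ->]] := to_limit_surj k.
rewrite (@jones_to 1 t t id id) //; congr to_limit.
by apply/ffunP => m; rewrite ffunE.
Qed.

Lemma jones_comp u v k : jones (u * v) k = jones u (jones v k).
Proof.
have [t0 [g0 ->]] := to_limit_surj k.
have [t1 [s1 [r1 [b1 [c1 [vb1 uc1]]]]]] := VM_common u v.
have [t [s [b [le vb]]]] : exists t s (b : leaf t -> leaf s),
    tree_le (tree_join t0 t1) t /\ carries v b by exact: carries_at.
have t0t := tree_le_trans (tree_joinl _ _) le.
have t1t := tree_le_trans (tree_joinr t0 t1) le.
have s1s : tree_le s1 s.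
  apply/tree_leP => m ms; have [b' bK b'K] := carries_bij vb.
  have [l [w lE]] := tree_le_leaf (b' (SeqSub ms)) t1t.
  exists (val (b1 l)); first exact: ssvalP.
  suff -> : m = val (b1 l) ++ w by exact: prefix_prefix.
  apply: wcat_word_inj => x; rewrite wcat_cat -vb1 -wcat_cat -lE vb b'K.
  by [].
have [r [c uc]] := carries_refine uc1 s1s.
have [b' bK b'K] := carries_bij vb; have [c' cK c'K] := carries_bij uc.
rewrite -(to_limit_iota g0 t0t) (jones_to _ bK b'K vb) (jones_to _ cK c'K uc).
have uvcb : carries (u * v) (c \o b) := carries_comp vb uc.
rewrite (jones_to _ (can_comp cK bK) (can_comp b'K c'K) uvcb).
by congr to_limit; apply/ffunP => m; rewrite !ffunE.
Qed.

(** The semidirect product: [Fraction k v] stands for [k * v], with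
    [v * k * v^-1 = jones v k]. *)
Record fraction := Fraction { frac_base : limit; frac_top : thompsonV }.

HB.instance Definition _ := gen_eqMixin fraction.
HB.instance Definition _ := gen_choiceMixin fraction.

Definition fracM (x y : fraction) : fraction :=
  Fraction (frac_base x * jones (frac_top x) (frac_base y))
           (frac_top x * frac_top y).
Definition frac1 : fraction := Fraction 1 1.
Definition fracV (x : fraction) : fraction :=
  Fraction (jones (frac_top x)^-1 (frac_base x)^-1) (frac_top x)^-1.

Lemma fracMA : associative fracM.
Proof.
by move=> [k u] [k' v] [k'' w]; rewrite /fracM /= jonesM jones_comp !mulgA.
Qed.
Lemma frac1M : left_id frac1 fracM.
Proof. by move=> [k v]; rewrite /fracM /= jones1 !mul1g. Qed.
Lemma fracM1 : right_id frac1 fracM.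
Proof. by move=> [k v]; rewrite /fracM /= multiplicative1 !mulg1. Qed.
Lemma fracVM : left_inverse frac1 fracV fracM.
Proof.
by move=> [k v]; rewrite /fracM /= -jonesM !mulVg multiplicative1.
Qed.
Lemma fracMV : right_inverse frac1 fracV fracM.
Proof.
by move=> [k v]; rewrite /fracM /= -jones_comp !mulgV jones1 mulgV.
Qed.

HB.instance Definition _ :=
  isGroup.Build fraction fracMA frac1M fracM1 fracVM fracMV.

End DirectLimit.

Definition equivariant (G H : groupType) (a0 a1 : {multiplicative G -> G})
    (b0 b1 : {multiplicative H -> H}) (f : limit a0 a1 -> limit b0 b1) : Prop :=
  forall v k, f (jones v k) = jones v (f k).

Definition trivial_endo (G : groupType) : {multiplicative G -> G} := one_fun G.

Definition nontrivial (G : groupType) : Prop := exists g : G, g <> 1.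

(* Main.v *)
(** Restricted to a right child, a representative of an element of [K] is
    trivial. Hence an element of [K] has finite support and is a product of
    elements concentrated at one point, whereas by injectivity an element of
    [K'], the limit for [b0] and [b1], never becomes trivial on a subcone of
    a leaf where it is not.

    (2), (3): if [k] in [K] and [k'] in [K'] have the same stabilizer in [V],
    then permuting leaves shows first that all coordinates of [k'] are equal,
    then that [k] is trivial.

    (1): the image of [K] under [K x| V -> K' x| V -> V], and likewise for the
    inverse, is a normal subgroup generated by two commuting conjugate
    subgroups, the images of the two halves of the base. If it were nontrivial,
    then it and in turn both of these subgroups would contain all even leaf
    permutations of large trees, which do not commute. So an
    isomorphism restricts to an embedding [kappa] of [K] into [K'] that is
    equivariant up to inner automorphisms, with respect to an injective
    morphism [rho] from [V] to [V]. Let [p <> 1] in [K] be concentrated at [x].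
    If [r] and [s] have disjoint supports and act on [q = kappa p], then
    [r.q * q^-1 * s.q = rs.q]; pulled back to [K], this shows that [rho r],
    [rho s] or [rho (r * s)] fixes [x], and then that [s^2] fixes [q] as soon
    as [rho r] moves [x]. Choosing [s] of order 3 makes coordinates of [q]
    agree that the first-letter flip [w] with [rho w x <> x] tells apart. *)

Require Import Defs.
From HB Require Import structures.
From mathcomp Require Import all_boot.
From mathcomp Require Import boolp classical_sets functions topology cantor.
From mathcomp Require Import all_fingroup gseries alt mathcomp_extra.

Set Implicit Arguments.
Unset Strict Implicit.
Unset Printing Implicit Defensive.

Local Open Scope group_scope.

Local Notation iota := Defs.iota.

(** * Elements of V permuting the leaves of a tree *)

(** Continuity is tested coordinate by coordinate; fixing the first [N] letters defines a
    neighbourhood, as a finite intersection of preimages of points of a discrete space. *)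
Lemma cantor_continuous (f : cantor_space -> cantor_space) :
  (forall x n, exists N, forall z,
    (forall i, i < N -> z i = x i) -> f z n = f x n) ->
  continuous f.
Proof.
move=> fP x; apply/cvg_sup => n A [_ [[B _ <-] Bfx BA]].
have [N fN] := fP x n.
suff : nbhs x [set z | forall i, i < N -> z i = x i]%classic.
  by apply: filterS => z /fN fz; apply: BA; rewrite /= fz.
elim: N {fN} => [|N IH]; first exact: filterS filterT.
have nN : nbhs x (@proj _ (fun=> bool) N @^-1` [set x N])%classic.
  exact: (@proj_continuous _ (fun=> bool) N x _ (discrete_set1 _)).
apply: filterS (filterI IH nN) => z [zx zN] i.
by rewrite ltnS leq_eqVlt => /orP[/eqP->|/zx].
Qed.

Lemma wcat_agree l y z n : (forall i, i < size l + n -> z i = wcat l y i) ->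
  exists2 y', z = wcat l y' & forall i, i < n -> y' i = y i.
Proof.
elim: l z => [|b l IH] z zE; first by exists z.
have [|y' zy' y'y] := IH (fun n => z n.+1).
  by move=> i lti; rewrite zE.
exists y' => //; rewrite (ccons_surj z) /= -zy'; congr ccons.
by rewrite (zE 0%N).
Qed.

Lemma wcat_agree_at m y y' n : (forall i, i <= n -> y' i = y i) ->
  wcat m y' n = wcat m y n.
Proof.
elim: m n => [|b m IH] [|n] //= E; first exact: E.
  exact: E.
by apply: IH => i /leqW/E.
Qed.

Lemma carries_continuous f t :
  (forall l : leaf t, exists m, forall x, f (wcat (val l) x) = wcat m x) ->
  continuous f.
Proof.
move=> fP; apply: cantor_continuous => x n.
have [l lt [y ->]] := leaf_cover t x; have [m mE] := fP (SeqSub lt).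
exists (size l + n.+1)%N => z /wcat_agree[y' -> y'y].
by rewrite !(mE : forall x, f (wcat l x) = _); exact: wcat_agree_at.
Qed.

Lemma carries_total t s (b : leaf t -> leaf s) :
  exists f, carries f b.
Proof.
have /choice[p pE] x : exists p : leaf t * cantor_space, x = wcat (val p.1) p.2.
  have [l lt [y ->]] := leaf_cover t x.
  by exists (SeqSub lt, y).
exists (fun x => wcat (val (b (p x).1)) (p x).2) => l x.
have E := pE (wcat (val l) x); set q := p _ in E *.
have El : l = q.1 by apply: val_inj; exact: leaf_disj (valP l) (valP q.1) E.
by rewrite -El in E *; rewrite (wcat_inj E).
Qed.

Lemma carries_ex t s (b : leaf t -> leaf s) : bijective b ->
  exists v : thompsonV, carries v b.
Proof.
move=> bb; have [c bK cK] := bb.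
have [f fb] := carries_total b; have [g gc] := carries_total c.
have fK : cancel f g.
  by move=> x; have [l lt [y ->]] := leaf_cover t x; rewrite (fb (SeqSub lt)) gc bK.
have gK : cancel g f.
  by move=> x; have [l lt [y ->]] := leaf_cover s x; rewrite (gc (SeqSub lt)) fb cK.
have fc : continuous f by apply: (@carries_continuous f t) => l; exists (val (b l)).
have gcc : continuous g by apply: (@carries_continuous g s) => l; exists (val (c l)).
by exists (ThompsonV fK gK fc gcc (carries_dyadic bb fb)).
Qed.

Lemma carries_uniq t s (b : leaf t -> leaf s) (u v : thompsonV) :
  carries u b -> carries v b -> u = v.
Proof.
move=> ub vb; apply: thompsonV_eq => x.
by have [l lt [y ->]] := leaf_cover t x; rewrite (ub (SeqSub lt)) (vb (SeqSub lt)).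
Qed.

(** The inverse makes [leaf_perm] a morphism, as [(s * r) m = r (s m)] for
    permutations whereas elements of [V] compose from right to left. *)
Lemma leaf_perm_ex t (s : {perm leaf t}) :
  exists v : thompsonV, carries v (s^-1)%g.
Proof. by apply: carries_ex; exists s; [exact: permKV | exact: permK]. Qed.

Definition leaf_perm t (s : {perm leaf t}) : thompsonV := projT1 (cid (leaf_perm_ex s)).

Lemma leaf_permP t (s : {perm leaf t}) :
  carries (leaf_perm s) (s^-1)%g.
Proof. by rewrite /leaf_perm; case: cid. Qed.

Lemma leaf_permM t : {morph @leaf_perm t : r s / r * s}.
Proof.
move=> r s; apply: (@carries_uniq _ _ ((r * s)^-1)%g).
  exact: leaf_permP.
move=> l x; rewrite VME (leaf_permP s) (leaf_permP r).
by rewrite invMg permM.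
Qed.

HB.instance Definition _ t :=
  isMultiplicative.Build {perm leaf t} thompsonV (@leaf_perm t) (@leaf_permM t).

Lemma leaf_perm1 t : leaf_perm (1 : {perm leaf t}) = 1.
Proof. exact: multiplicative1. Qed.

Lemma leaf_permV t (s : {perm leaf t}) : leaf_perm s^-1 = (leaf_perm s)^-1.
Proof. exact: multiplicativeV. Qed.

Lemma leaf_permE t (s : {perm leaf t}) (l : leaf t) x :
  leaf_perm s (wcat (val (s l)) x) = wcat (val l) x.
Proof. by rewrite leaf_permP permK. Qed.

Lemma leaf_perm_inj t : injective (@leaf_perm t).
Proof.
move=> r s E; apply/permP => l; apply: val_inj; apply: wcat_word_inj => x.
have := leaf_permE r l x; rewrite E -(leaf_permE s l x).
by move=> /(can_inj (VfunK _)).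
Qed.

Lemma jones_perm (G : groupType) (a0 a1 : {multiplicative G -> G}) t
    (s : {perm leaf t}) (g : {ffun leaf t -> G}) :
  jones (leaf_perm s) (to_limit a0 a1 g) = to_limit a0 a1 [ffun m => g (s m)].
Proof. exact: jones_to (permKV s) (permK s) (leaf_permP s). Qed.

(** * Germs *)

Lemma mem_attach t f l u :
  l \in leaves t -> u \in leaves (f l) -> l ++ u \in leaves (attach t f).
Proof.
elim: t f l => [|t0 IH0 t1 IH1] f l; first by rewrite inE => /eqP->.
rewrite leaves_NodeE; case: l => [|[] l] // lt uf; rewrite cat_cons leaves_NodeE.
  exact: (IH1 (f \o cons true)).
exact: (IH0 (f \o cons false)).
Qed.

Lemma attach_leaf t f m : m \in leaves (attach t f) ->
  exists l u, [/\ l \in leaves t, u \in leaves (f l) & m = l ++ u].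
Proof.
elim: t f m => [|t0 IH0 t1 IH1] f m; first by exists [::], m; rewrite inE.
rewrite [attach _ _]/= leaves_NodeE; case: m => [|[] m] //.
  move=> /IH1[l [u [lt uf ->]]]; exists (true :: l), u.
  by rewrite leaves_NodeE.
move=> /IH0[l [u [lt uf ->]]]; exists (false :: l), u.
by rewrite leaves_NodeE.
Qed.

Lemma tree_le_attach t f : tree_le t (attach t f).
Proof. by exists f. Qed.

Local Notation caret := (Node Leaf Leaf).

Lemma mem_attach_caret t l b :
  l \in leaves t -> rcons l b \in leaves (attach t (fun=> caret)).
Proof.
by move=> lt; rewrite -cats1; apply: mem_attach lt _; case: b.
Qed.

Lemma leaf_above t r (l : leaf t) y : tree_le t r -> exists (m : leaf r) w z,
  val m = val l ++ w /\ y = wcat w z.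
Proof.
move=> tr; have [m mr [z E]] := leaf_cover r (wcat (val l) y).
have [l' [w /= mE]] := tree_le_leaf (SeqSub mr) tr.
exists (SeqSub mr), w, z => /=.
have El : val l = val l'.
  by move: E; rewrite mE wcat_cat; exact: leaf_disj (valP l) (valP l').
by split; [rewrite El | move: E; rewrite mE wcat_cat El => /wcat_inj].
Qed.

Section Germs.
Variables (G : groupType) (a0 a1 : {multiplicative G -> G}).

Local Notation K := (limit a0 a1).
Local Notation to_K := (to_limit a0 a1).
Local Notation Gam t := {ffun leaf t -> G}.

(** Triviality of the germ of [k] at [x]. One representative suffices, since a coordinate that has
    become trivial stays trivial under refinement. *)
Definition trivial_at (x : cantor_space) (k : K) : Prop :=
  exists t (g : Gam t) (l : leaf t) y,
    [/\ k = to_K g, x = wcat (val l) y & g l = 1].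

Lemma trivial_at_ge x k : trivial_at x k -> exists t (g : Gam t),
  k = to_K g /\ forall r, tree_le t r ->
    exists (m : leaf r) z, x = wcat (val m) z /\ iota a0 a1 r g m = 1.
Proof.
move=> [t [g [l [y [-> -> gl]]]]]; exists t, g; split=> // r tr.
have [m [w [z [mE ->]]]] := leaf_above l y tr.
by exists m, z; rewrite mE wcat_cat (iotaE _ _ _ mE) gl alpha1.
Qed.

(** Compared with a trivial representative on a common refinement, the given [g] must die after
    finitely many letters along the path to the point. *)
Lemma trivial_at_to t (g : Gam t) (l : leaf t) y :
  trivial_at (wcat (val l) y) (to_K g) ->
  exists w z, y = wcat w z /\ alpha a0 a1 w (g l) = 1.
Proof.
move=> /trivial_at_ge[t' [g' [/to_limitP[r [tr t'r E]] H]]].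
have [m [z [xE]]] := H r t'r.
have [l' [w mE]] := tree_le_leaf m tr.
have El : l = l'.
  apply: val_inj; move: xE; rewrite mE wcat_cat.
  exact: leaf_disj (valP l) (valP l').
rewrite -E (iotaE _ _ _ mE) -El => gl; exists w, z; split=> //.
by move: xE; rewrite mE wcat_cat El => /wcat_inj.
Qed.

Lemma trivial_at_mul x k k' :
  trivial_at x k -> trivial_at x k' -> trivial_at x (k * k').
Proof.
move=> /trivial_at_ge[t [g [-> H]]] /trivial_at_ge[t' [g' [-> H']]].
have tr := tree_joinl t t'; have t'r := tree_joinr t t'.
have [m [z [xm gm]]] := H _ tr; have [m' [z' [xm' gm']]] := H' _ t'r.
exists (tree_join t t'), (iota a0 a1 _ g * iota a0 a1 _ g'), m, z; split=> //.
  by rewrite to_limitM !to_limit_iota.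
rewrite ffunE gm mul1g (_ : m = m') //.
apply: val_inj; move: xm'; rewrite xm.
exact: leaf_disj (valP m) (valP m').
Qed.

Lemma trivial_atV x k : trivial_at x k -> trivial_at x k^-1.
Proof.
move=> [t [g [l [y [-> xE gl]]]]]; exists t, g^-1, l, y; split=> //.
  by rewrite multiplicativeV.
by rewrite ffunE gl invg1.
Qed.

Lemma trivial_at_conj x k k' : trivial_at x k -> trivial_at x (k' * k * k'^-1).
Proof.
move=> /trivial_at_ge[t [g [-> H]]].
have [t' [g' [tt' ->]]] := limit_at k' t; have [m [z [xE gm]]] := H _ tt'.
exists t', (g' * iota a0 a1 t' g * g'^-1), m, z; split=> //.
  by rewrite !to_limitM multiplicativeV to_limit_iota.
by move: (iota _ _ _ _) gm => h hm; rewrite !ffunE hm mulg1 mulgV.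
Qed.

Lemma trivial_at_jones x (v : thompsonV) k :
  trivial_at x k -> trivial_at (v x) (jones v k).
Proof.
move=> /trivial_at_ge[t [g [-> H]]].
have [r [s [b [tr vb]]]] := carries_at v t; have [c bK cK] := carries_bij vb.
have [m [z [-> gm]]] := H _ tr.
rewrite -(to_limit_iota _ _ g tr); move: (iota _ _ _ _) gm => h hm.
exists s, [ffun l => h (c l)], (b m), z; split; last by rewrite ffunE bK.
  exact: jones_to bK cK vb.
exact: vb.
Qed.

End Germs.

(** * Elements concentrated at one point *)

Definition zeros : cantor_space := fun=> false.

Lemma wcat_zeros n : wcat (nseq n false) zeros = zeros.
Proof. by elim: n => //= n ->; apply/funext => -[]. Qed.

Lemma wcat_eq_zeros w z : wcat w z = zeros -> w = nseq (size w) false.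
Proof.
elim: w => //= b w IH; rewrite -(wcat_zeros 1) => /ccons_inj[-> /IH E].
by rewrite {1}E.
Qed.

(** Only the leaf [nseq n false] contains no letter 1, so when [a1] is trivial only the leftmost
    coordinate survives attaching this tree. *)
Fixpoint left_comb n := if n is n'.+1 then Node (left_comb n') Leaf else Leaf.

Lemma left_comb_leaf n u :
  u \in leaves (left_comb n) -> u = nseq n false \/ true \in u.
Proof.
elim: n u => [|n IH] u; first by rewrite inE => /eqP->; left.
rewrite [left_comb _]/= leaves_NodeE; case: u => [|[] u] //.
  by move=> _; right; rewrite mem_head.
by move=> /IH[->|ut]; [left | right; rewrite inE ut].
Qed.

Section OneSided.
Variables (G : groupType) (a : {multiplicative G -> G}).

Local Notation a1 := (trivial_endo G).
Local Notation K := (limit a a1).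
Local Notation to_K := (to_limit a a1).
Local Notation Gam t := {ffun leaf t -> G}.

Lemma alpha_true w (g : G) : true \in w -> alpha a a1 w g = 1.
Proof.
case/splitPr => w1 w2.
by rewrite -cat_rcons -cats1 !alpha_cat (_ : alpha _ _ [:: true] _ = 1) ?alpha1.
Qed.

(** Each coordinate dies after finitely many letters 0, and at once after a letter 1; a left comb
    that is deep enough for all leaves kills everything. *)
Lemma trivial_at_zeros t (g : Gam t) :
  (forall l : leaf t, trivial_at (wcat (val l) zeros) (to_K g)) -> to_K g = 1.
Proof.
move=> H.
have /choice[N NP] (l : leaf t) :
    exists n, alpha a a1 (nseq n false) (g l) = 1.
  have [w [z [/esym/wcat_eq_zeros E gl]]] := trivial_at_to (H l).
  by exists (size w); rewrite -E.
pose n := (\max_(l : leaf t) N l)%N.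
pose s := attach t (fun=> left_comb n).
have ts : tree_le t s := tree_le_attach _ _.
rewrite -(to_limit_iota _ _ g ts) -[RHS](limit1_to a a1 s); congr to_limit.
apply/ffunP => m; have [l [u [lt us mE]]] := attach_leaf (valP m).
rewrite (@iotaE _ _ _ _ _ g (SeqSub lt) _ u) // ffunE.
have [->|/alpha_true->//] := left_comb_leaf us.
have Nn : (N (SeqSub lt) <= n)%N by exact: leq_bigmax.
by rewrite -(subnKC Nn) nseqD alpha_cat NP alpha1.
Qed.

Lemma trivial_at_eq1 (k : K) : (forall x, trivial_at x k) -> k = 1.
Proof. by have [t [g ->]] := to_limit_surj k => H; exact: trivial_at_zeros. Qed.

Definition concentrated (x : cantor_space) (k : K) : Prop :=
  forall y, y <> x -> trivial_at y k.

Lemma concentrated_eq1 x k : concentrated x k -> trivial_at x k -> k = 1.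
Proof.
move=> kx kt; apply: trivial_at_eq1 => y.
by have [->|/kx] := pselect (y = x).
Qed.

Lemma concentratedM x k k' :
  concentrated x k -> concentrated x k' -> concentrated x (k * k').
Proof. by move=> kx k'x y yx; exact: trivial_at_mul (kx y yx) (k'x y yx). Qed.

Lemma concentratedV x k : concentrated x k -> concentrated x k^-1.
Proof. by move=> kx y yx; exact: trivial_atV (kx y yx). Qed.

Lemma concentrated_conj x k k' :
  concentrated x k -> concentrated x (k' * k * k'^-1).
Proof. by move=> kx y yx; exact: trivial_at_conj (kx y yx). Qed.

Lemma concentrated_jones x (v : thompsonV) k :
  concentrated x k -> concentrated (v x) (jones v k).
Proof.
move=> kx y yx; rewrite -[y](VinvK v); apply: trivial_at_jones; apply: kx => E.
by apply: yx; rewrite -E VinvK.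
Qed.

(** The candidates [d] keep one coordinate of [k0]. Were they all trivial, dividing by them would
    show that the germs of [k0] at the points [wcat (val l) zeros] are trivial. *)
Lemma concentrated_ex : nontrivial K -> exists x k, concentrated x k /\ k <> 1.
Proof.
move=> [k0 k01]; have [t [g kE]] := to_limit_surj k0; apply: contrapT => N.
apply: k01; rewrite kE; apply: trivial_at_zeros => l.
pose d : Gam t := [ffun m => if m == l then g l else 1].
have d1 : to_K d = 1.
  apply: contrapT => d1; apply: N; exists (wcat (val l) zeros), (to_K d).
  (* Outside the cone of [l] the condition is vacuous; inside, [n] is the place of a letter 1 in the
     tail, and a comb of depth [n.+1] separates [y] from the leftmost branch. *)
  split=> // y yl; have [n zn] : exists n, forall z,
      y = wcat (val l) z -> z n = true.
    apply: contrapT => /forallNP zn; apply: yl.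
    have [z yE] : exists z, y = wcat (val l) z.
      by apply: contrapT => nz; apply: (zn 0%N) => z yE; case: nz; exists z.
    rewrite yE; congr wcat; apply/funext => n; apply: negbTE; apply/negP => zn1.
    by apply: (zn n) => z'; rewrite yE => /wcat_inj<-.
  pose s := attach t (fun=> left_comb n.+1).
  have ts : tree_le t s := tree_le_attach _ _.
  have [m ms [z yE]] := leaf_cover s y.
  exists s, (iota a a1 s d), (SeqSub ms), z; split=> //.
    by rewrite to_limit_iota.
  have [k [u [kt us mE]]] := attach_leaf ms.
  rewrite (@iotaE _ _ _ _ _ d (SeqSub kt) _ u) // ffunE.
  case: eqP => [kl|_]; last exact: alpha1.
  have [uE|/alpha_true->//] := left_comb_leaf us.
  have : wcat u z n = true by apply: zn; rewrite yE mE wcat_cat -kl.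
  suff -> : wcat u z n = false by [].
  by rewrite uE; elim: (n) => //= p ->.
have -> : g = d * (d^-1 * g) by rewrite mulKVg.
rewrite to_limitM d1 mul1g.
exists t, (d^-1 * g), l, zeros; split=> //.
by rewrite !ffunE eqxx mulVg.
Qed.

End OneSided.

(** * Stabilizers *)

Section Injective.
Variables (H : groupType) (b0 b1 : {multiplicative H -> H}).
Hypotheses (b0I : injective b0) (b1I : injective b1).

Lemma alpha_inj w : injective (alpha b0 b1 w).
Proof.
elim: w => // b w IH g h; rewrite /alpha /= => /IH.
by case: b => [/b1I|/b0I].
Qed.

(** Every coordinate reappears in a refinement under some injective [alpha w]. *)
Lemma to_limit_inj t : injective (@to_limit H b0 b1 t).
Proof.
move=> g h /to_limitP[r [tr _ E]]; apply/ffunP => l.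
have [m [w [z [mE _]]]] := leaf_above l zeros tr.
by apply: (@alpha_inj w); rewrite -!(iotaE _ _ _ mE) E.
Qed.

End Injective.

(* Permutations of the leaves ending in 1 fix [k], hence [k'], so that by
   injectivity all coordinates of [k'] are equal; but then every permutation
   of leaves fixes [k'], hence [k], and moves the germ of [k] at [l000...] to
   a point where [k] is trivial. *)
Lemma same_stabilizer_eq1 (G H : groupType) (a : {multiplicative G -> G})
    (b0 b1 : {multiplicative H -> H})
    (k : limit a (trivial_endo G)) (k' : limit b0 b1) :
  injective b0 -> injective b1 ->
  (forall v, jones v k = k <-> jones v k' = k') -> k = 1.
Proof.
move=> b0I b1I stab; have [t0 [g0 kE0]] := to_limit_surj k.
have constant t h : tree_le t0 t -> k' = to_limit b0 b1 h ->
    forall l l' : leaf t, h l = h l'.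
  move=> t0t k'E l l'; pose s := attach t (fun=> caret).
  have ts : tree_le t s := tree_le_attach _ _.
  pose m := SeqSub (mem_attach_caret true (valP l)).
  pose m' := SeqSub (mem_attach_caret true (valP l')).
  have mE : val m = val l ++ [:: true] by rewrite cats1.
  have m'E : val m' = val l' ++ [:: true] by rewrite cats1.
  have /stab : jones (leaf_perm (tperm m m')) k = k.
    rewrite kE0 -(to_limit_iota _ _ g0 (tree_le_trans t0t ts)).
    rewrite -(iota_comp _ _ _ t0t ts); move: (iota _ _ t g0) => g.
    rewrite jones_perm; congr to_limit.
    have g1 (n : leaf t) (p : leaf s) :
        val p = val n ++ [:: true] -> iota a (trivial_endo G) s g p = 1.
      by move=> /iotaE->; rewrite alpha_true.
    apply/ffunP => p; rewrite [LHS]ffunE; case: tpermP => // ->.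
      by rewrite (g1 l') // (g1 l).
    by rewrite (g1 l) // (g1 l').
  rewrite k'E -(to_limit_iota _ _ h ts) jones_perm.
  move=> /(to_limit_inj b0I b1I)/ffunP/(_ m); rewrite [LHS]ffunE tpermL.
  by rewrite (iotaE _ _ _ mE) (iotaE _ _ _ m'E) => /(alpha_inj b0I b1I).
have [t [h [t0t k'E]]] := limit_at k' t0.
pose s := attach t (fun=> caret).
have ts : tree_le t s := tree_le_attach _ _.
have t0s := tree_le_trans t0t ts.
have kE : k = to_limit a (trivial_endo G) (iota a (trivial_endo G) t g0).
  by rewrite kE0 to_limit_iota.
rewrite kE; apply: trivial_at_zeros => l; rewrite -kE.
pose m := SeqSub (mem_attach_caret false (valP l)).
pose m' := SeqSub (mem_attach_caret true (valP l)).
have m'E : val m' = val l ++ [:: true] by rewrite cats1.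
have <- : jones (leaf_perm (tperm m m')) k = k.
  apply/stab; rewrite k'E -(to_limit_iota _ _ h ts) jones_perm.
  congr to_limit; apply/ffunP => p; rewrite [LHS]ffunE.
  by apply: constant t0s _ _ _; rewrite to_limit_iota.
have -> : wcat (val l) zeros =
    leaf_perm (tperm m m') (wcat (val m') zeros).
  have := leaf_permE (tperm m m') m zeros; rewrite tpermL => ->.
  by rewrite /= -cats1 wcat_cat (wcat_zeros 1).
apply: trivial_at_jones; rewrite kE -(to_limit_iota _ _ _ ts).
exists s, (iota a (trivial_endo G) s (iota a (trivial_endo G) t g0)), m', zeros.
by split=> //; rewrite (iotaE _ _ _ m'E) alpha_true.
Qed.

(** * Commuting normal subgroups in V *)

(** Some leaf [l] differs from [b l]. If neither word is a prefix of the other, the cone of [l] is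
    moved off itself. Otherwise let [c] be the next letter of the longer word: the opposite letter
    appended to [l] separates a subcone from its image. *)
Lemma moved_cone (u : thompsonV) : u <> 1 ->
  exists m, forall y y', u (wcat m y) <> wcat m y'.
Proof.
move=> u1; have [t [s [b ub]]] := thompsonV_carries u.
have [l /eqP lb] : exists l, val l <> val (b l).
  apply: contrapT => /forallNP H; apply: u1; apply: thompsonV_eq => x.
  have [l lt [y ->]] := leaf_cover t x; rewrite (ub (SeqSub lt)) V1E.
  by congr wcat; apply: contrapT => E; apply: (H (SeqSub lt)) => /esym.
have [/prefixP[[|c w] E]|] := boolP (prefix (val l) (val (b l))).
- by rewrite E cats0 eqxx in lb.
- exists (rcons (val l) (~~ c)) => y y'; rewrite -cats1 !wcat_cat ub E wcat_cat.
  by move=> /wcat_inj/ccons_inj[]; case: c {E}.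
have [/prefixP[[|c w] E]|] := boolP (prefix (val (b l)) (val l)).
- by rewrite E cats0 eqxx in lb.
- exists (rcons (val l) (~~ c)) => y y'; rewrite -cats1 !wcat_cat ub E wcat_cat.
  by move=> /wcat_inj/ccons_inj[]; case: c {E}.
move=> /negP bl /negP lbn; exists (val l) => y y'; rewrite ub.
by case/wcat_prefix.
Qed.

Fixpoint word_tree (m : word) : tree :=
  match m with
  | [::] => Leaf
  | false :: m' => Node (word_tree m') Leaf
  | true :: m' => Node Leaf (word_tree m')
  end.

Lemma mem_word_tree m : m \in leaves (word_tree m).
Proof. by elim: m => [|[] m IH] //; rewrite [word_tree _]/= leaves_NodeE. Qed.

(** The comb has five leaves, the number from which on alternating groups are simple; four leaves
    below [m] give room for two noncommuting 3-cycles. *)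
Lemma leaves_below m t : tree_le (attach (word_tree m) (fun=> left_comb 4)) t ->
  4 < #|{: leaf t}| /\ exists a b c d : leaf t,
    uniq [:: a; b; c; d] /\ all (fun p => prefix m (val p)) [:: a; b; c; d].
Proof.
move=> mt; have /choice[e eP] (u : leaf (left_comb 4)) :
    exists p : leaf t, exists w, val p = m ++ val u ++ w.
  have mu := mem_attach (f := fun=> left_comb 4) (mem_word_tree m) (valP u).
  have [p [w [_ [E _]]]] := leaf_above (SeqSub mu) zeros mt.
  by exists p, w; rewrite E /= catA.
have eI : injective e.
  move=> u u' E; have [w wE] := eP u; have [w' w'E] := eP u'.
  apply: val_inj; rewrite E w'E in wE.
  move/(congr1 (fun s => wcat (drop (size m) s) zeros)): wE.
  rewrite !drop_size_cat // !wcat_cat => /esym.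
  exact: leaf_disj (valP u) (valP u').
split.
  have := leq_card e eI; rewrite card_seq_sub //.
pose u0 := SeqSub (isT : [:: true] \in leaves (left_comb 4)).
pose u1 := SeqSub (isT : [:: false; true] \in leaves (left_comb 4)).
pose u2 := SeqSub (isT : [:: false; false; true] \in leaves (left_comb 4)).
pose u3 := SeqSub (isT : [:: false; false; false; true] \in leaves (left_comb 4)).
exists (e u0), (e u1), (e u2), (e u3); split.
  by rewrite -[[:: _; _; _; _]]/(map e [:: u0; u1; u2; u3]) map_inj_uniq.
have me u : prefix m (val (e u)) by have [w ->] := eP u; exact: prefix_prefix.
by rewrite /= !me.
Qed.

Definition is_subgroup (A : thompsonV -> Prop) :=
  [/\ A 1, forall u v, A u -> A v -> A (u * v) & forall v, A v -> A v^-1].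

Definition normalized_by (N A : thompsonV -> Prop) :=
  forall n v, N n -> A v -> A (n * v * n^-1).

(** By injectivity a point sent to a fixed point is that point, so each map preserves the set where
    it may move points. *)
Lemma disjoint_commute (u v : thompsonV) (S : cantor_space -> Prop) :
  (forall x, S x -> u x = x) -> (forall x, ~ S x -> v x = x) -> commute u v.
Proof.
move=> uS vS; apply: thompsonV_eq => x; rewrite !VME.
have [Sx|Sx] := pselect (S x).
  rewrite (uS x) // uS //; apply: contrapT => Svx; apply: (Svx).
  by rewrite (can_inj (VfunK v) (vS _ Svx)).
rewrite (vS x) // vS // => Sux; apply: (Sx).
by rewrite -(can_inj (VfunK u) (uS _ Sux)).
Qed.

Lemma leaf_perm_off_cone t (s : {perm leaf t}) m :
  (forall p : leaf t, ~~ prefix m (val p) -> s p = p) ->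
  forall x, ~ (exists y, x = wcat m y) -> leaf_perm s x = x.
Proof.
move=> sP x xm; have [l lt [y xE]] := leaf_cover t x.
have [/prefixP[w lE]|ml] := boolP (prefix m l).
  by case: xm; exists (wcat w y); rewrite xE lE wcat_cat.
by have := leaf_permE s (SeqSub lt) y; rewrite sP // -xE.
Qed.

(* If [h] moves the cone of [m] off itself and [f], [g] are supported in that
   cone, then [h f h^-1] commutes with [f] and [g], whence
   [[h, f], g] = [f^-1, g]: double commutators give elements of [A] with a
   prescribed action on the cone. *)
Lemma contains_Alt (N A : thompsonV -> Prop) :
  is_subgroup A -> normalized_by N A ->
  (exists t0, forall t (s : {perm leaf t}), tree_le t0 t ->
     s \in 'Alt_(leaf t) -> N (leaf_perm s)) ->
  (exists2 h, A h & h <> 1) ->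
  exists t1, forall t, tree_le t1 t ->
    (forall s : {perm leaf t}, s \in 'Alt_(leaf t) -> A (leaf_perm s)) /\
    exists f g : {perm leaf t},
      [/\ f \in 'Alt_(leaf t), g \in 'Alt_(leaf t) & f * g <> g * f].
Proof.
move=> [A1 AM AV] NA [t0 NAlt] [h Ah /moved_cone[m hm]].
exists (tree_join t0 (attach (word_tree m) (fun=> left_comb 4))) => t jt.
have t0t := tree_le_trans (tree_joinl _ _) jt.
have [card_t [a [b [c [d [abcd /=]]]]]] :=
  leaves_below (tree_le_trans (tree_joinr t0 _) jt).
rewrite andbT => /and4P[ma mb mc md].
move: abcd => /=; rewrite !inE !negb_or -!andbA andbT.
move=> /and5P[ab ac ad bc /andP[bd cd]].
pose f := tperm a b * tperm a c; pose g := tperm a b * tperm a d.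
have fAlt : f \in 'Alt_(leaf t) by rewrite Alt_even odd_permM !odd_tperm ab ac.
have gAlt : g \in 'Alt_(leaf t) by rewrite Alt_even odd_permM !odd_tperm ab ad.
have fg : f * g <> g * f.
  move=> /permP/(_ b); rewrite !permM tpermR tpermL tpermL.
  by rewrite !tpermD // 1?eq_sym // => /eqP; rewrite (negbTE cd).
split; last by exists f, g.
have off z p : prefix m (val z) -> ~~ prefix m (val p) -> z != p.
  by move=> mz; apply: contraNneq => <-.
have ffix p : ~~ prefix m (val p) -> f p = p.
  by move=> mp; rewrite permM !tpermD ?off.
have gfix p : ~~ prefix m (val p) -> g p = p.
  by move=> mp; rewrite permM !tpermD ?off.
clearbody f g.
pose F := leaf_perm f; pose g' := leaf_perm g; pose D := h * F * h^-1.
(* [h^-1] sends the cone of [m] off itself, to where [F] is the identity. *)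
have Dm x : (exists y, x = wcat m y) -> D x = x.
  move=> [y xE]; rewrite /D !VME /F (leaf_perm_off_cone ffix).
    exact: (VinvK h).
  move=> [y' E]; apply: (hm y' y); rewrite -E xE.
  exact: (VinvK h).
have DF : commute D F := disjoint_commute Dm (leaf_perm_off_cone ffix).
have Dg : commute D g' := disjoint_commute Dm (leaf_perm_off_cone gfix).
have Ad : A (D * F^-1).
  rewrite /D -2!mulgA; apply: AM => //.
  by rewrite mulgA; apply: NA; [exact: NAlt|exact: AV].
have Ae : A (leaf_perm (f^-1 * g * f * g^-1)%g).
  have -> : leaf_perm (f^-1 * g * f * g^-1)%g =
      (D * F^-1) * (g' * (D * F^-1)^-1 * g'^-1).
    rewrite !leaf_permM !leaf_permV -/F -/g' invMg invgK.
    have DV : commute D^-1 (g' * F * g'^-1).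
      apply/commute_sym/commuteV/commute_sym.
      by apply: commuteM; [exact: commuteM | exact: commuteV].
    have -> : g' * (F * D^-1) * g'^-1 = g' * F * g'^-1 * D^-1.
      rewrite -!mulgA; congr (_ * (_ * _)); apply: commuteV.
      by apply/commute_sym/commuteV/commute_sym.
    rewrite -DV !mulgA; congr (_ * _ * _ * _).
    by rewrite (commuteV DF : D * F^-1 = F^-1 * D) mulgK.
  by apply: AM => //; apply: NA; [exact: NAlt|exact: AV].
(* The even permutations lying in [A] form a normal subgroup of a simple group; the commutator of
   [f^-1] and [g] shows that it is nontrivial. *)
pose S := 'Alt_(leaf t) :&: [set s | `[<A (leaf_perm s)>] ]%SET.
have inS s : (s \in S) = (s \in 'Alt_(leaf t)) && `[<A (leaf_perm s)>].
  by rewrite finset.in_setI [in X in _ && X]inE.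
have gS : group_set S.
  apply/group_setP; split; first by rewrite inS group1 leaf_perm1; apply/asboolP.
  move=> r s; rewrite !inS => /andP[rA /asboolP Ar] /andP[sA /asboolP As].
  by rewrite groupM //= leaf_permM; apply/asboolP/AM.
have nS : group gS <| 'Alt_(leaf t).
  apply/andP; split; first by apply/fintype.subsetP => r; rewrite inS => /andP[].
  apply/fintype.subsetP => r rA; rewrite inE; apply/fintype.subsetP => _ /imsetP[s + ->].
  rewrite !inS => /andP[sA /asboolP As]; rewrite groupJ //=; apply/asboolP.
  rewrite conjgE mulgA !leaf_permM leaf_permV -{2}[leaf_perm r]invgK.
  by apply: NA => //; rewrite -leaf_permV; apply: NAlt => //; rewrite groupV.
have [_ /(_ _ nS)[S1|SA]] := simpleP _ (simple_Alt5 card_t).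
  have : (f^-1 * g * f * g^-1)%g \in S.
    by rewrite inS !groupM ?groupV //; apply/asboolP.
  rewrite -[S]/(gval (group gS)) S1 => /set1P.
  by move=> /(congr1 (fun s => f * s * g)); rewrite !mulgA mulgV mul1g mulg1 -!mulgA mulVg mulg1 => /esym.
by move=> s; rewrite -SA inS => /andP[_ /asboolP].
Qed.

(** [contains_Alt] applies first to [N], which all of [V] normalizes, then to [A] and [B], for which
    [N] normalizing them is enough. On a common tree some [f] in [A] and [g] in [B] fail to
    commute. *)
Lemma no_commuting_normal (N A B : thompsonV -> Prop) :
  is_subgroup N -> is_subgroup A -> is_subgroup B ->
  normalized_by (fun=> True) N -> normalized_by N A -> normalized_by N B ->
  (forall u v, A u -> B v -> commute u v) ->
  (forall u, A u -> N u) ->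
  (exists2 u, A u & u <> 1) -> (exists2 v, B v & v <> 1) -> False.
Proof.
move=> sN sA sB nN nA nB AB AN exA exB.
have exN : exists t0, forall t (s : {perm leaf t}), tree_le t0 t ->
    s \in 'Alt_(leaf t) -> N (leaf_perm s).
  have [|| t0 H] := contains_Alt sN nN; first by exists Leaf.
    by have [u /AN] := exA; exists u.
  by exists t0 => t s t0t; apply: (H t t0t).1.
have [tA HA] := contains_Alt sA nA exN exA.
have [tB HB] := contains_Alt sB nB exN exB.
have [AAlt [f [g [fAlt gAlt]]]] := HA _ (tree_joinl tA tB); apply.
have [BAlt _] := HB _ (tree_joinr tA tB).
apply: leaf_perm_inj; rewrite !leaf_permM.
by apply: AB; [exact: AAlt | exact: BAlt].
Qed.

Lemma flip_ex : exists w : thompsonV, forall b y, w (ccons b y) = ccons (~~ b) y.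
Proof.
have lE b : [:: b] \in leaves caret by case: b.
pose s := tperm (SeqSub (lE false)) (SeqSub (lE true)).
have sE b : s (SeqSub (lE (~~ b))) = SeqSub (lE b).
  by case: b; rewrite /s ?tpermL ?tpermR.
by exists (leaf_perm s) => b y; have := leaf_permE s (SeqSub (lE (~~ b))) y; rewrite sE.
Qed.

(** * The base of a fraction group *)

Section Fraction.
Variables (H : groupType) (b0 b1 : {multiplicative H -> H}).

Local Notation K := (limit b0 b1).
Local Notation to_K := (to_limit b0 b1).
Local Notation Gam t := {ffun leaf t -> H}.
Local Notation frac := (fraction b0 b1).

Definition Gam_supported (S : cantor_space -> Prop) t (g : Gam t) : Prop :=
  forall (l : leaf t) y, ~ S (wcat (val l) y) -> g l = 1.

Definition supported S (k : K) : Prop :=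
  exists t (g : Gam t), k = to_K g /\ Gam_supported S g.

Lemma iota_supported S t r (g : Gam t) : tree_le t r ->
  Gam_supported S g -> Gam_supported S (iota b0 b1 r g).
Proof.
move=> tr gS m y; have [l [w mE]] := tree_le_leaf m tr.
by rewrite (iotaE _ _ _ mE) mE wcat_cat => /gS->; exact: alpha1.
Qed.

Lemma supported_at S k t0 : supported S k ->
  exists t (g : Gam t), [/\ tree_le t0 t, k = to_K g & Gam_supported S g].
Proof.
move=> [t [g [-> gS]]]; have tj := tree_joinl t t0.
exists (tree_join t t0), (iota b0 b1 _ g); split; first exact: tree_joinr.
  by rewrite to_limit_iota.
exact: iota_supported.
Qed.

Lemma supported_at2 S S' k k' : supported S k -> supported S' k' ->
  exists t (g g' : Gam t), [/\ k = to_K g, k' = to_K g',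
    Gam_supported S g & Gam_supported S' g'].
Proof.
move=> [t [g [-> gS]]] /(supported_at t)[s [g' [ts -> g'S]]].
exists s, (iota b0 b1 _ g), g'; split=> //; first by rewrite to_limit_iota.
exact: iota_supported.
Qed.

Lemma supported1 S : supported S 1.
Proof. by exists Leaf, 1; split=> // l y _; rewrite ffunE. Qed.

Lemma supportedM S k k' : supported S k -> supported S k' -> supported S (k * k').
Proof.
move=> kS k'S; have [t [g [g' [-> -> gS g'S]]]] := supported_at2 kS k'S.
exists t, (g * g'); split; first by rewrite to_limitM.
by move=> l y Sy; rewrite ffunE (gS l y) // (g'S l y) // mulg1.
Qed.

Lemma supportedV S k : supported S k -> supported S k^-1.
Proof.
move=> [t [g [-> gS]]]; exists t, g^-1; split; first by rewrite multiplicativeV.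
by move=> l y Sy; rewrite ffunE (gS l y) // invg1.
Qed.

Lemma supported_conj S k k' : supported S k -> supported S (k' * k * k'^-1).
Proof.
move=> kS; have [t [h ->]] := to_limit_surj k'.
have hT : supported (fun=> True) (to_K h) by exists t, h; split.
have [s [g [h' [-> -> gS _]]]] := supported_at2 kS hT.
exists s, (h' * g * h'^-1); split; first by rewrite !to_limitM multiplicativeV.
by move=> l y Sy; rewrite !ffunE (gS l y) // mulg1 mulgV.
Qed.

Lemma supported_jones S (v : thompsonV) k :
  supported S k -> supported (S \o Vinv v) (jones v k).
Proof.
move=> [t0 [g0 [-> g0S]]]; have [t [s [b [t0t vb]]]] := carries_at v t0.
have [c bK cK] := carries_bij vb.
have := iota_supported t0t g0S; rewrite -(to_limit_iota _ _ g0 t0t).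
move: (iota _ _ _ _) => g gS; exists s, [ffun m => g (c m)]; split.
  exact: jones_to bK cK vb.
move=> m y Sy; rewrite ffunE; apply: (gS _ y) => Scy; apply: Sy.
by rewrite /= -{1}[m]cK -vb VfunK.
Qed.

Lemma supported_commute S S' k k' : (forall x, S x -> ~ S' x) ->
  supported S k -> supported S' k' -> commute k k'.
Proof.
move=> SS' kS k'S; have [t [g [g' [-> -> gS g'S]]]] := supported_at2 kS k'S.
rewrite /commute -!to_limitM; congr to_limit; apply/ffunP => l; rewrite !ffunE.
have [/SS' Sl|Sl] := pselect (S (wcat (val l) zeros)).
  by rewrite (g'S l zeros) // mulg1 mul1g.
by rewrite (gS l zeros) // mulg1 mul1g.
Qed.

Definition half (b : bool) (x : cantor_space) : Prop := x 0%N = b.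

Lemma half_split k : exists k0 k1,
  [/\ supported (half false) k0, supported (half true) k1 & k = k0 * k1].
Proof.
(* On a tree above the caret every leaf has a first letter, so the default of [head] never
   matters. *)
have [t [g [+ ->]]] := limit_at k caret.
case: t g => [|t0 t1] g ct; first by move: ct => [f].
pose p b : Gam (Node t0 t1) :=
  [ffun l => if head true (val l) == b then g l else 1].
have pS b : supported (half b) (to_K (p b)).
  exists (Node t0 t1), (p b); split=> // l y; rewrite ffunE.
  have := valP l; rewrite leaves_NodeE; case: (val l) => // c m _ /eqP/=.
  by rewrite /half /= => /negbTE->.
exists (to_K (p false)), (to_K (p true)); split=> //.
rewrite -to_limitM; congr to_limit; apply/ffunP => l; rewrite !ffunE.
by case: head; rewrite ?mulg1 ?mul1g.
Qed.

Definition of_base (k : K) : frac := Fraction k 1.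

Lemma of_baseM : {morph of_base : k k' / k * k'}.
Proof. by move=> k k'; congr Fraction; rewrite /= ?jones1 ?mulg1. Qed.

HB.instance Definition _ := isMultiplicative.Build K frac of_base of_baseM.

Lemma of_base_conj (x : frac) (k : K) : x * of_base k * x^-1 =
  of_base (frac_base x * jones (frac_top x) k * (frac_base x)^-1).
Proof.
apply: (canLR (mulgK x)); case: x => h v; congr Fraction => /=.
  by rewrite jones1 mulgKV.
by rewrite mulg1 mul1g.
Qed.

(** The image [N] of the base is normal because [phi] is onto. The images of the two halves commute
    and are exchanged by conjugation with the image of the flip, so both are nontrivial if [N]
    is. *)
Lemma base_to_V_trivial (phi : {multiplicative frac -> thompsonV}) :
  (forall v, exists x, phi x = v) -> forall k : K, phi (of_base k) = 1.
Proof.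
move=> phi_surj k; apply: contrapT => phik.
pose A (S : cantor_space -> Prop) v :=
  exists2 k, supported S k & v = phi (of_base k).
pose N := A (fun=> True).
have phiJ x h : phi x * phi (of_base h) * (phi x)^-1 =
    phi (of_base (frac_base x * jones (frac_top x) h * (frac_base x)^-1)).
  by rewrite -of_base_conj !gmulfM multiplicativeV.
have sA S : is_subgroup (A S).
  split.
  - by exists 1; [exact: supported1 | rewrite multiplicative1].
  - move=> _ _ [h hS ->] [h' h'S ->]; exists (h * h'); first exact: supportedM.
    by rewrite of_baseM gmulfM.
  - move=> _ [h hS ->]; exists h^-1; first exact: supportedV.
    by rewrite -multiplicativeV -multiplicativeV.
have AN S : normalized_by N (A S).
  move=> _ _ [h _ ->] [h' h'S ->]; exists (h * h' * h^-1).
    exact: supported_conj.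
  by rewrite phiJ /= jones1.
have VN : normalized_by (fun=> True) N.
  move=> v _ _ [h hS ->]; have [x <-] := phi_surj v.
  rewrite phiJ; eexists; last by [].
  have [t [g ->]] := to_limit_surj (frac_base x * jones (frac_top x) h * (frac_base x)^-1).
  by exists t, g; split.
have [w wE] := flip_ex.
have AA b : (exists2 v, A (half b) v & v <> 1) ->
    exists2 v, A (half (~~ b)) v & v <> 1.
  move=> [_ [h hS ->] h1].
  pose x : frac := Fraction 1 w.
  exists (phi x * phi (of_base h) * (phi x)^-1).
    rewrite phiJ; eexists; last by [].
    rewrite /= mul1g invg1 mulg1.
    have [t [g [-> gS]]] := supported_jones w hS; exists t, g; split=> // l y Sy.
    apply: (gS _ y) => /= Swy; apply: Sy; rewrite -[wcat _ _](VinvK w).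
    by rewrite (ccons_surj (Vinv w _)) wE /half /= Swy.
  move=> E; apply: h1.
  by apply: (@mulgI _ (phi x)); rewrite mulg1 -[LHS](mulgKV (phi x)) E mul1g.
have [k0 [k1 [k0S k1S kE]]] := half_split k.
have exA : exists b, exists2 v, A (half b) v & v <> 1.
  apply: contrapT => /forallNP nA; apply: phik.
  rewrite kE of_baseM gmulfM.
  have A1 b h : supported (half b) h -> phi (of_base h) = 1.
    move=> hS; apply: contrapT => h1; apply: (nA b).
    by exists (phi (of_base h)) => //; exists h.
  by rewrite (A1 _ _ k0S) (A1 _ _ k1S) mulg1.
have exAb b : exists2 v, A (half b) v & v <> 1.
  by have [c /[dup] H0 /AA H1] := exA; case: b c H0 H1 => -[].
apply: (no_commuting_normal (sA (fun=> True)) (sA (half false)) (sA (half true))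
  VN (AN _) (AN _)) => //.
- move=> _ _ [h hS ->] [h' h'S ->]; rewrite /commute -!gmulfM; congr (phi (of_base _)).
  by apply: (supported_commute _ hS h'S) => x; rewrite /half => ->.
- move=> _ [h hS ->]; exists h => //.
  by have [t [g ->]] := to_limit_surj h; exists t, g; split.
Qed.

End Fraction.

(** * Twisted equivariant embeddings *)

Lemma move_into_cone m x : exists (v : thompsonV) y, v x = wcat m y.
Proof.
have [l lt [y ->]] := leaf_cover (word_tree m) x.
pose p := SeqSub lt; pose q := SeqSub (mem_word_tree m).
exists (leaf_perm (tperm p q)), y.
by have := leaf_permE (tperm p q) q y; rewrite tpermR.
Qed.

Definition flip_word (m : word) : word := if m is b :: m' then ~~ b :: m' else m.

(** [P] only sees the word behind its first letter, which a flip keeps; so the map is an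
    involution. *)
Lemma flip_perm_ex s (P : pred word) : exists r : {perm leaf (Node s s)},
  forall m, val (r m) = if P (behead (val m)) then flip_word (val m) else val m.
Proof.
have flip_mem m : m \in leaves (Node s s) -> flip_word m \in leaves (Node s s).
  by rewrite !leaves_NodeE; case: m => // -[].
have /choice[f fE] (m : leaf (Node s s)) : exists m' : leaf (Node s s),
    val m' = if P (behead (val m)) then flip_word (val m) else val m.
  by case: ifP => _; [exists (SeqSub (flip_mem _ (valP m))) | exists m].
have fI : injective f.
  apply: inv_inj => m; apply: val_inj; rewrite !fE.
  case: (boolP (P (behead (val m)))) => [Pm|/negbTE->//].
    by case: (val m) Pm => [|b m'] /= ->; rewrite ?negbK.
by exists (perm fI) => m; rewrite permE fE.
Qed.

Definition flip_perm s P := projT1 (cid (flip_perm_ex s P)).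

Lemma flip_permE s P m : val (flip_perm s P m) =
  if P (behead (val m)) then flip_word (val m) else val m.
Proof. by rewrite /flip_perm; case: cid. Qed.

Lemma flip_permM s P : flip_perm s predT = flip_perm s (predC P) * flip_perm s P.
Proof.
apply/permP => m; apply: val_inj; rewrite permM !flip_permE /=.
case Pm: (P (behead (val m))) => /=; first by rewrite Pm.
by move: Pm; case: (val m) => [|b m'] /= ->.
Qed.

Lemma leaf_perm_flip s (w : thompsonV) :
  (forall b y, w (ccons b y) = ccons (~~ b) y) ->
  w = leaf_perm (flip_perm s predT).
Proof.
move=> wE; apply: thompsonV_eq => x; have [m mt [y ->]] := leaf_cover (Node s s) x.
set r := flip_perm s predT.
have rK : r (r (SeqSub mt)) = SeqSub mt.
  by apply: val_inj; rewrite !flip_permE /=; case: (m) => //= b m'; rewrite negbK.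
have /= := leaf_permE r (r (SeqSub mt)) y; rewrite rK /= => ->.
have /= -> := flip_permE predT (SeqSub mt).
case: m mt {r rK} => [|b m] mt; first by rewrite leaves_NodeE in mt.
exact: wE.
Qed.

Lemma tree_le_Node t0 t1 s0 s1 :
  tree_le t0 s0 -> tree_le t1 s1 -> tree_le (Node t0 t1) (Node s0 s1).
Proof.
move=> [f0 ->] [f1 ->].
by exists (fun w => if w is b :: w' then if b then f1 w' else f0 w' else Leaf).
Qed.

Lemma prefix_rcons_neq l c (m : word) :
  prefix (rcons l c) m -> prefix (rcons l (~~ c)) m = false.
Proof.
elim: l m => [|b l IH] [|b' m] //=; first by rewrite !prefix0s !andbT => /eqP<-; case: c.
by case/andP=> -> /IH->.
Qed.

Section TwistedEmbedding.
Variables (G H : groupType) (a : {multiplicative G -> G}).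
Variables (b0 b1 : {multiplicative H -> H}).
Hypotheses (b0I : injective b0) (b1I : injective b1).

Local Notation K := (limit a (trivial_endo G)).
Local Notation K' := (limit b0 b1).
Local Notation to_K' := (to_limit b0 b1).

Variables (kappa : {multiplicative K -> K'}).
Variables (rho : {multiplicative thompsonV -> thompsonV}) (c : thompsonV -> K).
Hypotheses (kappaI : injective kappa) (rhoI : injective rho).

(** An isomorphism of semidirect products need not preserve [V]: hence the reparametrization [rho]
    and the inner correction by [c w]. *)
Local Notation twist w k := (c w * jones (rho w) k * (c w)^-1).

Hypothesis kappa_twist : forall w k, jones w (kappa k) = kappa (twist w k).

Lemma concentrated_twist x w k :
  concentrated x k -> concentrated (rho w x) (twist w k).
Proof. by move=> kx; exact/concentrated_conj/concentrated_jones. Qed.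

Section DisjointPerms.
Variables (t : tree) (p : K) (h : {ffun leaf t -> H}) (x : cantor_space).
Hypotheses (px : concentrated x p) (p1 : p <> 1) (ph : kappa p = to_K' h).
Variables r s : {perm leaf t}.
Hypothesis rs : forall m, r m = m \/ s m = m.

(* The relation [r.q * q^-1 * s.q = (r * s).q] holds for [q = kappa p], by
   inspection of the coordinates. Pulled back to [K] it expresses [p] through
   three elements concentrated at the images of [x]. *)
Lemma disjoint_perms_fix :
  [\/ rho (leaf_perm r) x = x, rho (leaf_perm s) x = x
    | rho (leaf_perm (r * s)) x = x].
Proof.
apply: contrapT => N; apply: p1; apply: (concentrated_eq1 px).
pose q (u : {perm leaf t}) := twist (leaf_perm u) p.
have qE u : kappa (q u) = to_K' [ffun m => h (u m)].
  by rewrite -kappa_twist ph jones_perm.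
have qt u : rho (leaf_perm u) x <> x -> trivial_at x (q u).
  by move=> ux; apply: (concentrated_twist (w := leaf_perm u) px) => /esym.
have E : q r * p^-1 * q s = q (r * s).
  apply: kappaI; rewrite (gmulfM _ (q s)) (gmulfM (q r)) multiplicativeV !qE ph.
  rewrite -multiplicativeV -!to_limitM; congr to_limit.
  apply/ffunP => m; rewrite !ffunE permM.
  have [rm|sm] := rs m; first by rewrite rm mulgV mul1g.
  have -> : s (r m) = r m.
    by have [/perm_inj rm|//] := rs (r m); rewrite rm sm.
  by rewrite sm mulgKV.
have -> : p = q s * (q (r * s))^-1 * q r.
  rewrite -E; move: (q r) (q s) => u v.
  by rewrite !invMg invgK !mulgA mulgV mul1g mulgKV.
by apply: trivial_at_mul; [apply: trivial_at_mul; last apply: trivial_atV|];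
  apply: qt => ux; apply: N; [constructor 2|constructor 3|constructor 1].
Qed.

End DisjointPerms.

(** Applied to [r], [s] and to [r], [s * s], [disjoint_perms_fix] shows that the image of [s * s]
    under [rho] fixes [x]. So [d], which compares [p] with its translate by [s * s], is concentrated
    at [x]. *)
Lemma disjoint_square t p (h : {ffun leaf t -> H}) x (r s : {perm leaf t}) :
  concentrated x p -> p <> 1 -> kappa p = to_K' h ->
  (forall m, r m = m \/ s m = m) ->
  rho (leaf_perm r) x <> x -> forall m, h (s (s m)) = h m.
Proof.
move=> px p1 ph rs rx.
have rss m : r m = m \/ (s * s) m = m.
  by have [->|sm] := rs m; [left | right; rewrite permM !sm].
have ssx : rho (leaf_perm (s * s)) x = x.
  have [//|sx|rsx] := disjoint_perms_fix px p1 ph rs.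
    by rewrite leaf_permM gmulfM VME !sx.
  have [//|//|] := disjoint_perms_fix px p1 ph rss.
  rewrite mulgA (leaf_permM (r * s)) (gmulfM (leaf_perm (r * s))) VME => E.
  have sx : rho (leaf_perm s) x = x.
    by apply: (can_inj (VfunK (rho (leaf_perm (r * s))))); rewrite E rsx.
  by rewrite leaf_permM gmulfM VME !sx.
pose d := p^-1 * twist (leaf_perm (s * s)) p.
have dx : concentrated x d.
  apply: concentratedM; first exact: concentratedV.
  by rewrite -{1}ssx; exact: concentrated_twist.
have dE : kappa d = to_K' [ffun m => (h m)^-1 * h (s (s m))].
  rewrite /d gmulfM -kappa_twist multiplicativeV ph jones_perm.
  rewrite -multiplicativeV -to_limitM; congr to_limit.
  by apply/ffunP => m; rewrite !ffunE permM.
(* [kappa d] has trivial coordinates at the leaves fixed by [s], and [r] moves only such leaves. As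
   [rho] of [r] moves [x], this forces [d = 1]. *)
have rd : twist (leaf_perm r) d = d.
  apply: kappaI; rewrite -kappa_twist dE jones_perm; congr to_limit.
  apply/ffunP => m; rewrite !ffunE; have [->//|sm] := rs m.
  have srm : s (r m) = r m.
    by have [/perm_inj rm|//] := rs (r m); rewrite rm sm.
  by rewrite !srm !sm !mulVg.
have d1 : d = 1.
  apply: (concentrated_eq1 dx); rewrite -rd; apply: (concentrated_twist dx).
  by move=> /esym.
move: dE; rewrite d1 multiplicative1 -(limit1_to b0 b1 t : _ = 1).
move=> /(to_limit_inj b0I b1I)/ffunP E m; have := E m; rewrite !ffunE.
by move=> /(congr1 (mulg (h m))); rewrite mulg1 mulKVg.
Qed.

Lemma no_twisted_embedding : ~ nontrivial K.
Proof.
move=> /concentrated_ex[x0 [k0 [k0x k01]]].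
have [w wE] := flip_ex.
have w1 : w <> 1.
  move=> E; have := wE true zeros; rewrite E V1E.
  by move=> /ccons_inj[].
have /moved_cone[m wm] : rho w <> 1.
  by move=> E; apply: w1; apply: rhoI; rewrite E multiplicative1.
(* Translating [k0] into the cone of [m] makes [rho w] move its point of concentration. *)
have [v [y vx]] := move_into_cone m x0.
pose x := v x0; pose p := jones v k0.
have px : concentrated x p by exact: concentrated_jones.
have p1 : p <> 1.
  move=> E; apply: k01; rewrite -(jones1 k0) -(mulVg v) jones_comp -/p E.
  exact: multiplicative1.
have wx : rho w x <> x by rewrite /x vx; exact: wm.
have [s [h hE]] : exists s (h : {ffun leaf (Node s s) -> H}), kappa p = to_K' h.
  have [t [g [+ ->]]] := limit_at (kappa p) caret.
  case: t g => [|t0 t1] g ct; first by move: ct => [f].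
  exists (tree_join t0 t1), (iota b0 b1 _ g); rewrite to_limit_iota //.
  by apply: tree_le_Node; [exact: tree_joinl | exact: tree_joinr].
(* Otherwise [w] fixes [kappa p], and the germ of [p] at [x] is trivial because [rho w] moves
   [x]. *)
have [l hl] : exists l, h (flip_perm s predT l) <> h l.
  apply: contrapT => /forallNP hs; apply: p1; apply: (concentrated_eq1 px).
  have <- : twist w p = p.
    apply: kappaI; rewrite -kappa_twist hE (leaf_perm_flip s wE) jones_perm.
    congr to_limit; apply/ffunP => l; rewrite !ffunE.
    by apply: contrapT; exact: hs.
  by apply: (concentrated_twist px) => /esym.
set l2 := flip_perm s predT l in hl.
(* Each old leaf gets two new leaves on either side [b]: enough for a 3-cycle on [A0], [A1], [B0]
   that stays on one side. *)
pose s' := attach s (fun=> Node caret caret).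
have ts : tree_le (Node s s) (Node s' s') := tree_le_attach _ (fun=> Node caret caret).
pose h' := iota b0 b1 (Node s' s') h.
have h'E : kappa p = to_K' h' by rewrite to_limit_iota.
have memT (u : word) (q : leaf (Node s s)) : size u = 2 ->
    val q ++ u \in leaves (Node s' s').
  move=> u2; apply: (mem_attach (f := fun=> Node caret caret) (valP q)).
  by case: u u2 => [|[] [|[] []]].
(* If [rho] of [r] moved [x], the 3-cycle [r2], whose square sends [A0] to [B0], would give
   [h l2 = h l] by injectivity of [alpha]. *)
have fix_below b (r : {perm leaf (Node s' s')}) :
    (forall q, prefix (rcons (behead (val l)) b) (behead (val q)) -> r q = q) ->
    rho (leaf_perm r) x = x.
  move=> rP; apply: contrapT => rx.
  pose A0 := SeqSub (memT [:: b; false] l erefl).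
  pose A1 := SeqSub (memT [:: b; true] l erefl).
  pose B0 := SeqSub (memT [:: b; false] l2 erefl).
  pose r2 := tperm A0 A1 * tperm A0 B0.
  have l2E : val l2 = flip_word (val l) by rewrite flip_permE.
  have below q : q \in [:: A0; A1; B0] ->
      prefix (rcons (behead (val l)) b) (behead (val q)).
    rewrite !inE; have := valP l; rewrite leaves_NodeE.
    case lE : (val l) => [//|d l'] _.
    by case/or3P => /eqP->; rewrite /= ?l2E lE /= -cat_rcons prefix_prefix.
  have rr2 q : r q = q \/ r2 q = q.
    have [/below/rP|] := boolP (q \in [:: A0; A1; B0]); first by left.
    rewrite !inE !negb_or => /and3P[q0 q1 qB]; right.
    by rewrite permM !tpermD // eq_sym.
  have := disjoint_square px p1 h'E rr2 rx A0.
  have -> : r2 (r2 A0) = B0.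
    have A1E q d : val q = d ++ [:: b; false] -> q != A1.
      move=> qE; apply/eqP => /(congr1 (last false \o val)).
      by rewrite /= qE !last_cat.
    have -> : r2 A0 = A1.
      by rewrite permM tpermL tpermD //; [exact: (A1E _ (val l)) | exact: (A1E _ (val l2))].
    by rewrite permM tpermR tpermL.
  rewrite (@iotaE _ _ _ _ _ h l2 B0 [:: b; false]) //.
  by rewrite (@iotaE _ _ _ _ _ h l A0 [:: b; false]) // => /(alpha_inj b0I b1I).
(* The flip splits into the part below [rcons (behead (val l)) false] and the rest. Each part avoids
   one side, so its image under [rho] fixes [x]. *)
apply: wx; rewrite (leaf_perm_flip s' wE).
rewrite (flip_permM _ (prefix (rcons (behead (val l)) false))).
rewrite leaf_permM gmulfM VME (fix_below true) ?(fix_below false) // => q qP.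
- by apply: val_inj; rewrite flip_permE /= qP.
- by apply: val_inj; rewrite flip_permE (prefix_rcons_neq qP).
Qed.

End TwistedEmbedding.

(** * Isomorphisms of fraction groups *)

Section FractionTop.
Variables (H : groupType) (b0 b1 : {multiplicative H -> H}).

Definition of_top (v : thompsonV) : fraction b0 b1 := Fraction 1 v.

Lemma of_topM : {morph of_top : u v / u * v}.
Proof. by move=> u v; congr Fraction; rewrite /= multiplicative1 mulg1. Qed.

HB.instance Definition _ := isMultiplicative.Build _ _ of_top of_topM.

Lemma frac_topM : {morph @frac_top H b0 b1 : x y / x * y}.
Proof. by []. Qed.

HB.instance Definition _ :=
  isMultiplicative.Build _ _ (@frac_top H b0 b1) frac_topM.

Lemma of_base_frac (x : fraction b0 b1) :
  frac_top x = 1 -> x = of_base (frac_base x).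
Proof. by case: x => k v /= ->. Qed.

Lemma of_top_conj v k : of_top v * of_base k * (of_top v)^-1 = of_base (jones v k).
Proof. by rewrite of_base_conj /= invg1 mul1g mulg1. Qed.

End FractionTop.

(** Followed by the projection to [V], an isomorphism is onto [V], so [base_to_V_trivial]
    applies. *)
Lemma iso_base (G H : groupType) (a0 a1 : {multiplicative G -> G})
    (b0 b1 : {multiplicative H -> H})
    (f : {multiplicative fraction a0 a1 -> fraction b0 b1}) :
  bijective f -> forall k, f (of_base k) = of_base (frac_base (f (of_base k))).
Proof.
move=> [g fK gK] k; apply: of_base_frac.
apply: (base_to_V_trivial (phi := @frac_top H b0 b1 \o f)) => v.
by exists (g (of_top b0 b1 v)); rewrite /= gK.
Qed.

Section Isomorphism.
Variables (G H : groupType) (a : {multiplicative G -> G}).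
Variables (b0 b1 : {multiplicative H -> H}).
Variables (f : {multiplicative fraction a (trivial_endo G) -> fraction b0 b1}).
Variables (g : {multiplicative fraction b0 b1 -> fraction a (trivial_endo G)}).
Hypotheses (fK : cancel f g) (gK : cancel g f).

Definition base_map k := frac_base (f (of_base k)).

Lemma base_mapE k : f (of_base k) = of_base (base_map k).
Proof. by apply: iso_base; exists g. Qed.

Lemma base_mapM : {morph base_map : k k' / k * k'}.
Proof.
by move=> k k'; rewrite /base_map of_baseM gmulfM !base_mapE -of_baseM.
Qed.

HB.instance Definition _ := isMultiplicative.Build _ _ base_map base_mapM.

Definition top_map v := frac_top (g (of_top b0 b1 v)).

Lemma top_mapM : {morph top_map : u v / u * v}.
Proof. by move=> u v; rewrite /top_map of_topM gmulfM. Qed.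

HB.instance Definition _ := isMultiplicative.Build _ _ top_map top_mapM.

Lemma iso_no_twisted_embedding : injective b0 -> injective b1 ->
  ~ nontrivial (limit a (trivial_endo G)).
Proof.
move=> b0I b1I.
apply: (@no_twisted_embedding _ _ _ _ _ b0I b1I base_map top_map
  (fun v => frac_base (g (of_top b0 b1 v)))).
- move=> k k' E; have := base_mapE k; rewrite [base_map k]E -base_mapE.
  by move=> /(can_inj fK)[].
(* If [g] sends [v] into the base, then so does [f] after [g], as [f] preserves the base; but the
   base meets [V] trivially. *)
- have ker v : top_map v = 1 -> v = 1.
    move=> /of_base_frac/(congr1 f); rewrite gK base_mapE.
    by move=> /(congr1 (@frac_top _ _ _)).
  move=> u v E; apply: (mulIg v^-1); rewrite mulgV; apply: ker.
  by rewrite top_mapM E -top_mapM mulgV [LHS](multiplicative1 top_map).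
- move=> v k; apply: (congr1 (@frac_base _ b0 b1) (x := of_base _) (y := of_base _)).
  rewrite -[RHS]base_mapE -of_base_conj !gmulfM multiplicativeV gK base_mapE.
  by rewrite of_top_conj.
Qed.

End Isomorphism.

Theorem theoremB (G H : groupType) (a : {multiplicative G -> G})
    (b0 b1 : {multiplicative H -> H}) :
  injective b0 -> injective b1 ->
  [/\ nontrivial (limit a (trivial_endo G)) \/ nontrivial (limit b0 b1) ->
      ~ exists f : {multiplicative fraction a (trivial_endo G) -> fraction b0 b1},
          bijective f,
      nontrivial (limit b0 b1) ->
      ~ exists f : {multiplicative limit b0 b1 -> limit a (trivial_endo G)},
          injective f /\ equivariant f
    & nontrivial (limit a (trivial_endo G)) ->
      ~ exists f : {multiplicative limit a (trivial_endo G) -> limit b0 b1},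
          injective f /\ equivariant f].
Proof.
move=> b0I b1I; split.
- move=> KK' [f [g fK gK]].
  have gM : {morph g : x y / x * y}.
    by move=> x y; apply: (can_inj fK); rewrite gmulfM !gK.
  pose g' : {multiplicative _ -> _} := HB.pack g (isMultiplicative.Build _ _ g gM).
  have K1 := iso_no_twisted_embedding (g := g') fK gK b0I b1I.
  (* By [K1] the first base is trivial, so the second is not, although [g] embeds it into the
     first. *)
  have [//|[k k1]] := KK'; apply: k1.
  have gk : g' (of_base k) = 1.
    rewrite iso_base; last by exists f.
    rewrite (_ : frac_base _ = 1) ?multiplicative1 //.
    by apply: contrapT => gk; apply: K1; eexists; exact: gk.
  have := gK (of_base k); rewrite [g _]gk multiplicative1.
  by move=> /(congr1 (@frac_base _ _ _)).
(* Injectivity and equivariance give [k] and [f k] the same stabilizer. Here [f k] lies in the limit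
   with a trivial endomorphism; in the last case [k] does. *)
- move=> [k k1] [f [fI fE]]; apply: k1; apply: (fI); rewrite multiplicative1.
  apply: (same_stabilizer_eq1 b0I b1I (k' := k)) => v; rewrite -fE.
  by split=> [/fI|->].
- move=> [k k1] [f [fI fE]]; apply: k1.
  apply: (same_stabilizer_eq1 b0I b1I (k' := f k)) => v; rewrite -fE.
  by split=> [->|/fI].
Qed.
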